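(* The $Z_4$-Subdivision problem can be solved in $O(n^4(n+m))$ time, where $n$ and $m$ are the numbers of vertices and arcs of the input digraph.
   Context: All digraphs are strict. $Z_4$ is the digraph with vertex set $\{a,b,c,d\}$ and arc set $\{da,db,dc,ba,bc\}$. A subdivision of a digraph $F$ (an $F$-subdivision) is a digraph obtained from $F$ by replacing each arc $xy$ of $F$ by a directed path from $x$ to $y$. The $F$-Subdivision problem: given a digraph $D$, decide whether $D$ contains an $F$-subdivision as a subdigraph. *)

(* Defs.v *)
From mathcomp Require Import all_boot.

Set Implicit Arguments.
Unset Strict Implicit.
Unset Printing Implicit Defensive.

(** * Digraphs and subdivisions *)

(* Strict digraphs: a relation rules out parallel arcs, irreflexivity rules
   out loops; directed 2-cycles are allowed. *)
Record digraph := Digraph {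
  vertex :> finType;
  is_arc : rel vertex;
  arc_irrefl : irreflexive is_arc }.

Definition nvertices (D : digraph) : nat := #|vertex D|.

Definition narcs (D : digraph) : nat := #|[set p : D * D | is_arc p.1 p.2]|.

(* [S] is obtained from [F] by replacing each arc [xy] of [F] by a directed
   path from [x] to [y]: [f x] is the vertex of [S] standing for [x], and
   [P x y] lists the internal vertices of the path replacing [xy] (it may be
   empty, and is irrelevant when [xy] is not an arc).  Internal vertices are new
   and not shared, and [S] has no other vertex and no other arc. *)
Definition is_subdivision (F S : digraph) : Prop :=
  exists (f : F -> S) (P : F -> F -> seq S),
  [/\ injective f,
      forall x y, is_arc x y ->
        [/\ path (@is_arc S) (f x) (rcons (P x y) (f y)),
            uniq (P x y)
          & forall z, f z \notin P x y],
      forall x y x' y', is_arc x y -> is_arc x' y' -> (x, y) <> (x', y') ->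
        [disjoint P x y & P x' y'],
      forall v, (exists x, v = f x) \/
                (exists x y, is_arc x y /\ v \in P x y)
    & forall u v, is_arc u v -> exists x y, is_arc x y /\
        (u, v) \in zip (f x :: P x y) (rcons (P x y) (f y))].

Definition is_subdigraph (S D : digraph) : Prop :=
  exists h : S -> D,
    injective h /\ forall u v, is_arc u v -> is_arc (h u) (h v).

(* The yes-instances of F-Subdivision. *)
Definition has_subdivision (F D : digraph) : Prop :=
  exists S : digraph, is_subdivision F S /\ is_subdigraph S D.

(* The vertices a, b, c, d are 0, 1, 2, 3. *)
Definition Z4_arc : rel 'I_4 := fun x y =>
  (val x, val y) \in [:: (3, 0); (3, 1); (3, 2); (1, 0); (1, 2)].

Lemma Z4_arc_irrefl : irreflexive Z4_arc.
Proof. by case=> [[|[|[|[|]]]] ]. Qed.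

Definition Z4 : digraph := Digraph Z4_arc_irrefl.

(** * Unit-cost word RAM

    Programs are given in structured form, over finitely many registers and
    finitely many arrays.  Every elementary operation costs one time unit. *)

Inductive binop := OpAdd | OpSub | OpMul | OpEq | OpLt.

Inductive expr :=
  | Const of nat
  | Reg of nat
  | Read of nat & expr                (* Read a i: the cell i of array a *)
  | Op of binop & expr & expr.

Inductive cmd :=
  | Skip
  | Assign of nat & expr
  | Write of nat & expr & expr        (* Write a i e: a[i] := e *)
  | Seq of cmd & cmd
  | If of expr & cmd & cmd
  | While of expr & cmd.

Record state := State { reg : nat -> nat; mem : nat -> nat -> nat }.

Definition eval_op (o : binop) (x y : nat) : nat :=
  match o with
  | OpAdd => x + y
  | OpSub => x - y
  | OpMul => x * y
  | OpEq => x == y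
  | OpLt => x < y
  end.

Fixpoint eval (s : state) (e : expr) : nat :=
  match e with
  | Const k => k
  | Reg r => reg s r
  | Read a i => mem s a (eval s i)
  | Op o e1 e2 => eval_op o (eval s e1) (eval s e2)
  end.

Fixpoint cost (e : expr) : nat :=
  match e with
  | Const _ | Reg _ => 1
  | Read _ i => (cost i).+1
  | Op _ e1 e2 => (cost e1 + cost e2).+1
  end.

Definition put_reg (s : state) (r v : nat) : state :=
  State (fun r' => if r' == r then v else reg s r') (mem s).

Definition put_mem (s : state) (a i v : nat) : state :=
  State (reg s)
    (fun a' i' => if (a' == a) && (i' == i) then v else mem s a' i').

(* [exec W c s t s']: from [s], the program [c] halts after [t] time units in
   [s'], without ever writing a value or using a write address larger than
   [W]; a run that would do so is stuck.  The relation is deterministic. *)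
Inductive exec (W : nat) : cmd -> state -> nat -> state -> Prop :=
  | ExecSkip s : exec W Skip s 1 s
  | ExecAssign s r e : eval s e <= W ->
      exec W (Assign r e) s (cost e).+1 (put_reg s r (eval s e))
  | ExecWrite s a i e : eval s i <= W -> eval s e <= W ->
      exec W (Write a i e) s (cost i + cost e).+1
        (put_mem s a (eval s i) (eval s e))
  | ExecSeq c1 c2 s t1 s1 t2 s2 :
      exec W c1 s t1 s1 -> exec W c2 s1 t2 s2 ->
      exec W (Seq c1 c2) s (t1 + t2) s2
  | ExecIfTrue e c1 c2 s t s' :
      eval s e != 0 -> exec W c1 s t s' ->
      exec W (If e c1 c2) s (cost e + t).+1 s'
  | ExecIfFalse e c1 c2 s t s' :
      eval s e = 0 -> exec W c2 s t s' ->
      exec W (If e c1 c2) s (cost e + t).+1 s'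
  | ExecWhileTrue e c s t1 s1 t2 s2 :
      eval s e != 0 -> exec W c s t1 s1 -> exec W (While e c) s1 t2 s2 ->
      exec W (While e c) s (cost e + t1 + t2).+1 s2
  | ExecWhileFalse e c s :
      eval s e = 0 -> exec W (While e c) s (cost e).+1 s.

(** * Input format and running time *)

(* [adj] is a list of out-adjacency lists of [D], for some numbering of the
   vertices by 0, ..., n-1 and some ordering of each list. *)
Definition adjacency_lists (D : digraph) (adj : seq (seq nat)) : Prop :=
  exists num : D -> 'I_(nvertices D),
  [/\ injective num,
      size adj = nvertices D
    & forall u : D,
        perm_eq (nth [::] adj (num u)) [seq val (num v) | v <- enum (is_arc u)]].

(* Register 0 holds n and register 1 holds m.  The lists are stored one after
   the other in array 1, the list of vertex i from cell (array 0)[i] up to,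
   excluding, cell (array 0)[i+1].  All the rest is 0. *)
Definition input (adj : seq (seq nat)) : state :=
  State (nth 0 [:: size adj; size (flatten adj)])
    (fun a => match a with
              | 0 => nth 0 (0 :: scanl addn 0 (map size adj))
              | 1 => nth 0 (flatten adj)
              | _ => fun=> 0
              end).

(* The decision problem [P] on digraphs can be solved in O(T(n, m)) time.  The
   same program must work for all digraphs and all their adjacency lists; its
   answer is read in register 0.  Words have O(log(n+m)) bits, i.e. stored
   values are polynomially bounded.  The successor in the time bound only
   matters where T vanishes, as no program halts in 0 steps. *)
Definition solvable_in_time (P : digraph -> Prop) (T : nat -> nat -> nat) :
    Prop :=
  exists (c : cmd) (C k : nat), forall (D : digraph) (adj : seq (seq nat)),
  let n := nvertices D in
  let m := narcs D in
  adjacency_lists D adj ->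
  exists (t : nat) (s : state),
    [/\ exec (C * (n + m).+1 ^ k) c (input adj) t s,
        t <= C * (T n m).+1
      & reg s 0 != 0 <-> P D].

(* Main.v *)
(** A Z4-subdivision is two fans: three paths from [d] to [a], [b], [c] that
    share only [d], and two paths from [b] to [a], [c] that share only [b] and
    avoid [d].  Conversely, if two such fans exist for some [a], [b], [c], [d],
    whatever the intersections between them, then a Z4-subdivision exists: in a
    pair of fans of minimum total length, most crossings could be used to move
    [a], [b] or [c] closer to [d], and the only one that may remain, the path
    from [b] to [c] meeting the path from [d] to [a] (or symmetrically), yields
    a Z4-subdivision with another vertex in the role of [b].

    By Menger's theorem the existence of the fans depends only on whether
    [x] is reachable from [d] in [D - {u, v}], for all [d], [u], [v], [x].
    Tabulating this takes [n ^ 3] searches of cost [O(n (n + m))]; then the pairs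
    [x], [y] with a fan from [d] in [D - u] are tabulated in time [O(n ^ 5)], and
    there is a fan from [d] to [{a, b, c}] iff for every [u] two of [a], [b], [c]
    have a fan from [d] in [D - u]. *)
Require Import Defs.
From mathcomp Require Import all_boot zify.

Set Implicit Arguments.
Unset Strict Implicit.
Unset Printing Implicit Defensive.

(** * Hall's theorem and Menger's theorem for fans *)

(** Turns distinctness of vertices along paths into linear inequalities on multiplicities, so that
    disjointness goals fall to arithmetic. *)
Lemma uniq_countP (T : eqType) (s : seq T) :
  uniq s <-> forall x, count_mem x s <= 1.
Proof.
split=> [us x|h]; first by rewrite count_uniq_mem // leq_b1.
apply: count_mem_uniq => x; case: (boolP (x \in s)) => [|/count_memPn //].
by rewrite -has_pred1 has_count; have := h x; lia.
Qed.

Lemma mem_count (T : eqType) (s : seq T) (x : T) :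
  (x \in s) = (0 < count_mem x s).
Proof. by rewrite -has_pred1 has_count. Qed.

(** Halmos-Vaughan induction on the size of [A]: a tight nonempty proper subset and its complement
    are matched separately; if there is none, any single edge may be fixed. [r0] supplies values
    when [A] is empty. *)
Lemma hall (L R : finType) (r0 : R) (r : L -> R -> bool) (A : {set L}) :
  (forall S : {set L}, S \subset A ->
     #|S| <= #|[set y | [exists x in S, r x y]]|) ->
  exists f : L -> R, {in A &, injective f} /\ {in A, forall x, r x (f x)}.
Proof.
have [k] := ubnP #|A|; elim: k r A => // k IHk r A leAk hA.
have [A0|[x xA]] := set_0Vmem A.
  by exists (fun=> r0); split=> x; rewrite A0 inE.
pose N (S : {set L}) := [set y | [exists x in S, r x y]].
case: (pickP (fun S : {set L} => [&& S \subset A, S != set0, S != A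
    & #|N S| <= #|S|])) => [S /and4P[sSA S0 SA tS]|loose].
- have ltS : #|S| < #|A| by rewrite proper_card // properEneq SA.
  have [f [fi fr]] : exists f : L -> R,
      {in S &, injective f} /\ {in S, forall x, r x (f x)}.
    by apply: IHk => [|S' sS']; [lia | apply: hA; apply: subset_trans sSA].
  (* The rest is matched outside [N S]: as [S] is tight, Hall's condition for [S :|: S'] leaves at
     least [#|S'|] neighbours of [S'] there. *)
  have [g [gi gr]] : exists g : L -> R, {in A :\: S &, injective g} /\
      {in A :\: S, forall x, r x (g x) && (g x \notin N S)}.
    apply: (IHk (fun x y => r x y && (y \notin N S))).
      have := cardsD A S; have := S0; rewrite -card_gt0 (setIidPr sSA); lia.
    move=> S' sS'; have dS : [disjoint S & S'].
      by rewrite disjoint_sym; move: sS'; rewrite subsetD => /andP[].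
    have := hA (S :|: S'); rewrite subUset sSA (subset_trans sS') ?subsetDl //.
    move=> /(_ isT); rewrite cardsU (disjoint_setI0 dS) cards0 subn0 => h.
    have : N (S :|: S') \subset N S :|:
        [set y | [exists x in S', r x y && (y \notin N S)]].
      apply/subsetP=> y; rewrite !in_setU [y \in [set _ | _]]inE.
      case: (boolP (y \in N S)) => //= yN; rewrite inE => /existsP[z /andP[zSS rz]].
      move: zSS; rewrite inE => /orP[zS|zS'].
        by case/negP: yN; rewrite inE; apply/existsP; exists z; rewrite zS.
      by apply/existsP; exists z; rewrite zS' rz.
    move/subset_leq_card; have := leq_card_setU (N S)
      [set y | [exists x in S', r x y && (y \notin N S)]].
    case=> + _; rewrite -/(N (S :|: S')) in h *; lia.
  have fN z : z \in S -> f z \in N S.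
    by move=> zS; rewrite inE; apply/existsP; exists z; rewrite zS fr.
  exists (fun z => if z \in S then f z else g z); split=> [y z yA zA|z zA].
    case: ifP => yS; case: ifP => zS; first exact: fi.
    - move=> fg; have := gr z; rewrite inE zS => /(_ zA) /andP[_].
      by rewrite -fg fN.
    - move=> fg; have := gr y; rewrite inE yS => /(_ yA) /andP[_].
      by rewrite fg fN.
    - by apply: gi; rewrite inE ?yS ?zS.
  case: ifP => zS; first exact: fr.
  by have := gr z; rewrite inE zS => /(_ zA) /andP[].
(* Without tight subsets, every nonempty [S] inside [A :\ x] has a spare neighbour, so removing [y]
   preserves Hall's condition. *)
- have [y rxy] : exists y, r x y.
    have := hA [set x]; rewrite sub1set cards1 => /(_ xA) /card_gt0P[y].
    by rewrite inE => /existsP[z /andP[/set1P->]]; exists y.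
  have [g [gi gr]] : exists g : L -> R, {in A :\ x &, injective g} /\
      {in A :\ x, forall z, r z (g z) && (g z != y)}.
    apply: (IHk (fun z w => r z w && (w != y))).
      by move: leAk; rewrite (cardsD1 x) xA.
    move=> S sS; have [->|S0] := eqVneq S set0; first by rewrite cards0.
    have sSA : S \subset A by apply: subset_trans sS (subsetDl _ _).
    have SA : S != A.
      by apply/eqP => SA; move/subsetP/(_ x): sS; rewrite SA xA !inE eqxx => /(_ isT).
    have := loose S; rewrite sSA S0 SA /= => /negbT; rewrite -ltnNge.
    have : N S \subset y |: [set w | [exists z in S, r z w && (w != y)]].
      apply/subsetP=> w; rewrite !inE; case: eqVneq => //= wy /existsP[z /andP[zS rz]].
      by apply/existsP; exists z; rewrite zS rz.
    move/subset_leq_card; rewrite cardsU1; lia.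
  exists (fun z => if z == x then y else g z); split=> [z w zA wA|z zA].
    case: eqVneq => [->|zx]; case: eqVneq => [->|wx] //.
    - by move=> yg; have := gr w; rewrite !inE wx -yg eqxx andbF => /(_ wA).
    - by move=> yg; have := gr z; rewrite !inE zx yg eqxx andbF => /(_ zA).
    - by apply: gi; rewrite !inE ?zx ?wx.
  case: eqVneq => [->|zx] //.
  by have := gr z; rewrite !inE zx zA => /(_ isT) /andP[].
Qed.

(** The condition forbids entering [U] but not leaving it, so [d] stays usable as a start even if it
    lies in [U]. *)
Lemma fan_menger (T : finType) (e : rel T) (d : T) (X : {set T}) :
  d \notin X ->
  (forall U : {set T}, #|U| < #|X| ->
     exists2 x, x \in X & connect [rel i j | e i j && (j \notin U)] d x) ->
  exists p : T -> seq T,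
    {in X, forall x, path e d (rcons (p x) x) /\ uniq (d :: rcons (p x) x)} /\
    {in X &, forall x y z, z \in rcons (p x) x -> z \in rcons (p y) y -> x = y}.
Proof.
move=> dX conn.
(* The elements of [X] stand for [#|X|] copies of [d].  A permutation of the
   vertices other than [d] that sends every copy of [d] to an out-neighbour of
   [d], and every other [v] to itself or to an out-neighbour, decomposes into
   the required paths and fixed points: trace back from each [x] in [X]. *)
pose r v w := (w != d) && (if v \in X then e d w else (v == w) || e v w).
have [S /subsetP sS|f [fi fr]] := @hall T T d r [set~ d].
  (* If the boundary [U] of [W] had fewer than [#|X|] vertices, it would
     separate [d] from [X]. *)
  pose W := d |: S :\: X.
  pose U := [set w | (w \notin W) && [exists v in W, e v w]].
  have dS : d \notin S by apply/negP => /sS; rewrite !inE eqxx.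
  (* Away from [X] and [d] a vertex is related to itself, so a set [S] missing [X] lies in its own
     neighbourhood. *)
  have [S0|/set0Pn[z]] := eqVneq (S :&: X) set0.
    apply/subset_leq_card/subsetP=> v vS; rewrite inE; apply/existsP; exists v.
    have vX : v \notin X.
      by apply/negP => vX; move/setP/(_ v): S0; rewrite !inE vS vX.
    by rewrite vS /r (negPf vX) eqxx andbT; apply: contraNneq dS => <-.
  rewrite inE => /andP[zS zX].
  have leU : #|X| <= #|U|.
    rewrite leqNgt; apply/negP => /conn[x xX /connectP[p pp lp]].
    have : x \in W.
      have : d \in W by rewrite !inE eqxx.
      rewrite lp; elim: p (d) pp {lp} => //= y p IHp v /andP[/andP[evy yU] pp] vW.
      apply: IHp => //; apply: contraNT yU => yW; rewrite inE yW.
      by apply/existsP; exists v; rewrite vW.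
    by rewrite !inE xX /= orbF => /eqP xd; rewrite -xd xX in dX.
  (* These are disjoint parts of the neighbourhood, [z] acting as a copy of [d]; by [leU] they
     number at least [#|S|]. *)
  have sN : (S :\: X) :|: U \subset [set y | [exists x in S, r x y]].
    apply/subsetP=> w; rewrite in_setU => /orP[|].
      rewrite !inE => /andP[wX wS]; apply/existsP; exists w.
      by rewrite wS /r (negPf wX) eqxx andbT; apply: contraNneq dS => <-.
    rewrite !inE negb_or => /andP[/andP[wd _] /existsP[v]].
    rewrite !inE => /andP[/orP[/eqP->|/andP[vX vS]] evw]; apply/existsP.
      by exists z; rewrite zS /r zX wd.
    by exists v; rewrite vS /r (negPf vX) wd evw orbT.
  have := subset_leq_card sN; rewrite cardsU.
  have -> : (S :\: X) :&: U = set0.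
    apply/setP=> w; rewrite !inE; case: (w \in S) => /=; last by rewrite andbF.
    by case: (w \in X); rewrite //= orbT.
  rewrite cards0; have := cardsID X S; have := subset_leq_card (subsetIr S X); lia.
(* Fixing [d] extends the matching to a permutation of all of [T]. *)
pose h v := if v == d then d else f v.
have hd v : (h v == d) = (v == d).
  rewrite /h; case: (eqVneq v d) => [_|vd]; first exact: eqxx.
  by have := fr v; rewrite !inE vd => /(_ isT)/andP[/negPf].
have hi : injective h.
  move=> v w; rewrite /h; case: (eqVneq v d) => [->|vd].
    by move/esym/eqP; rewrite -/(h w) hd => /eqP.
  case: (eqVneq w d) => [->|wd]; first by move/eqP; have := hd v; rewrite /h (negPf vd) => ->.
  by apply: fi; rewrite !inE.
have hr v : v != d -> if v \in X then e d (h v) else (v == h v) || e v (h v).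
  by move=> vd; rewrite /h (negPf vd); have := fr v; rewrite !inE vd => /(_ isT)/andP[].
pose g := finv h.
have gK : cancel g h by apply: f_finv.
have gi : injective g by apply: can_inj gK.
have gX x : x \in X -> exists k, (0 < k) && (iter k g x \in X).
  move=> xX; exists (order g x); rewrite order_gt0 iter_order //.
have [k kP] : exists k : T -> nat, forall x, x \in X ->
    [/\ 0 < k x, iter (k x) g x \in X &
      forall j, 0 < j < k x -> iter j g x \notin X].
  exists (fun x => if (insub x : option {x | x \in X}) is Some u
                   then ex_minn (gX (val u) (valP u)) else 0) => x xX.
  rewrite insubT /=; case: ex_minnP => m /andP[m0 mX] min.
  split=> // j /andP[j0 jm]; apply/negP => jX.
  by have := min j; rewrite j0 jX => /(_ isT); lia.
have gd x j : x != d -> iter j g x != d.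
  move=> xd; elim: j => //= j IHj; rewrite -hd gK //.
(* Cancelling [i] steps makes [x] an iterate of [y] before the first return of [y] to [X], which
   forces the remaining number of steps to be 0. *)
have key x y i j : x \in X -> y \in X -> i < k x -> j < k y ->
    iter i g x = iter j g y -> x = y /\ i = j.
  wlog ij : x y i j / i <= j => [wl|] xX yX ik jk E.
    by have [|/ltnW] := leqP i j => ij; [|have [] := wl y x j i ij yX xX jk ik (esym E)]; auto.
  have {}E : x = iter (j - i) g y.
    have git : injective (iter i g) by elim: (i) => //= m IHm v w /gi /IHm.
    by apply: git; rewrite -iterD subnKC.
  have [_ _ /(_ (j - i))] := kP y yX; rewrite -E xX.
  have [ji|] := posnP (j - i); last by move=> j0 /(_ _)/negP; case; lia.
  by move=> _; move: E; rewrite ji /=; split=> //; lia.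
(* The backward orbit of [x], stopped just before it returns to [X] and then reversed. *)
pose p x := rev (traject g (g x) (k x).-1).
have pE x : x \in X -> rcons (p x) x = rev (traject g x (k x)).
  by case/kP => + _ _; rewrite /p; case: (k x) => //= m _; rewrite rev_cons.
exists p; split=> [x xX|x y xX yX z].
  have xd : x != d by apply: contraNneq dX => <-.
  have [k0 kX kmin] := kP x xX; rewrite pE //; split.
    have pth j : j < k x -> path e (iter j g x) (rev (traject g x j)).
      elim: j => // j IHj jk; rewrite trajectSr rev_rcons /= IHj ?andbT; last by lia.
      have := hr (iter j.+1 g x) (gd _ _ xd); rewrite (negPf (kmin j.+1 _)) ?jk //.
      rewrite /= gK => /orP[/eqP E|//].
      have := key x x j j.+1 xX xX _ jk; rewrite /= E => /(_ (ltnW jk) erefl)[_]; lia.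
    (* The orbit returns to a copy of [d], so the vertex just before the return is an out-neighbour
       of [d]. *)
    have := hr (iter (k x) g x) (gd _ _ xd); rewrite kX -{1}(prednK k0) /= gK => edx.
    by rewrite -(prednK k0) trajectSr rev_rcons /= edx pth ?prednK.
  rewrite cons_uniq mem_rev rev_uniq; apply/andP; split.
    by apply/trajectP => -[i ik E]; have := gd x i xd; rewrite -E eqxx.
  rewrite -(prednK k0) looping_uniq; apply/negP => /trajectP[i ik E].
  have [||] := key x x _ _ xX xX _ _ E; lia.
rewrite !pE // !mem_rev => /trajectP[i ik ->] /trajectP[j jk E].
by have [] := key x y i j xX yX ik jk E.
Qed.

(** * From a pair of fans to a Z4-subdivision *)

Definition z4_paths (T : eqType) (e : rel T) (a b c d : T)
    (pa pb pc ra rc : seq T) : Prop :=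
  [/\ [/\ path e d (rcons pa a), path e d (rcons pb b) & path e d (rcons pc c)],
      path e b (rcons ra a), path e b (rcons rc c)
    & uniq ([:: a; b; c; d] ++ pa ++ pb ++ pc ++ ra ++ rc)].

Definition z4_model (T : eqType) (e : rel T) : Prop :=
  exists a b c d pa pb pc ra rc, z4_paths e a b c d pa pb pc ra rc.

(** The two fans may meet each other; [d] heads the second list because the fan from [b] has to
    avoid it. *)
Definition fan_pair (T : eqType) (e : rel T) (a b c d : T)
    (pa pb pc ra rc : seq T) : Prop :=
  [/\ [/\ path e d (rcons pa a), path e d (rcons pb b) & path e d (rcons pc c)],
      path e b (rcons ra a), path e b (rcons rc c),
      uniq (d :: rcons pa a ++ rcons pb b ++ rcons pc c)
    & uniq [:: d, b & rcons ra a ++ rcons rc c]].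

(* The context is cleared because lia would split on each of its booleans. *)
Ltac count_lia :=
  repeat match goal with
    | |- context [count ?p ?s] => move: (count p s) => ?
    | |- context [nat_of_bool (?x == ?y)] => move: (nat_of_bool (x == y)) => ?
    end; clear; lia.

Lemma has_split_last (T : Type) (P : pred T) (s : seq T) :
  has P s -> exists s1 z s2, [/\ s = s1 ++ z :: s2, P z & ~~ has P s2].
Proof.
elim: s => // x s IHs /=; case: (boolP (has P s)) => [hs _|hs].
  by have [s1 [z [s2 [-> Pz h]]]] := IHs hs; exists (x :: s1), z, s2.
by rewrite orbF => Px; exists [::], x, s.
Qed.

Lemma disjoint_count0 (T : eqType) (s t : seq T) : ~~ has (mem s) t ->
  forall x, count_mem x s = 0 \/ count_mem x t = 0.
Proof.
move=> /hasPn h x; case: (posnP (count_mem x s)) => [|xs]; first by left.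
right; apply/count_memPn/negP => /h /=.
by rewrite mem_count xs.
Qed.

(** Exchanging [a] and [c] lets each one-sided reduction serve for both. *)
Lemma fan_pair_sym (T : eqType) (e : rel T) a b c d pa pb pc ra rc :
  fan_pair e a b c d pa pb pc ra rc -> fan_pair e c b a d pc pb pa rc ra.
Proof.
case=> [[Pa Pb Pc] Ra Rc /uniq_countP U1 /uniq_countP U2]; split=> //.
  by apply/uniq_countP => x; have := U1 x; rewrite /= !count_cat /=; count_lia.
by apply/uniq_countP => x; have := U2 x; rewrite /= !count_cat /=; count_lia.
Qed.

Section Reductions.
Variables (T : eqType) (e : rel T) (a b c d : T) (pa pb pc ra rc : seq T).
Hypothesis H : fan_pair e a b c d pa pb pc ra rc.

Lemma shorten_ra_pb : has (mem pb) ra ->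
  exists b' pb' ra' rc', fan_pair e a b' c d pa pb' pc ra' rc' /\
    size pb' + size ra' + size rc' < size pb + size ra + size rc.
Proof.
(* The new [b] is the last vertex [z] of [ra] on [pb]; the new [rc] first
   follows [pb] from [z] to [b]. *)
case: H => [[Pa Pb Pc] Ra Rc /uniq_countP U1 /uniq_countP U2].
case/has_split_last=> ra1 [z [ra2 [Era zpb /disjoint_count0 N]]].
case/splitPr: zpb => pb1 pb2 in Pb U1 N *.
move: Pb; rewrite rcons_cat rcons_cons -cat_rcons cat_path last_rcons => /andP[Pb1 Pb2].
move: Ra; rewrite Era rcons_cat rcons_cons -cat_rcons cat_path last_rcons => /andP[_ Ra2].
(* [rc] may cross [pb], so this concatenation is only a walk, from which [shortenP] takes a simple
   path. *)
have : path e z (rcons pb2 b ++ rcons rc c) by rewrite cat_path Pb2 last_rcons.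
have : last z (rcons pb2 b ++ rcons rc c) = c by rewrite last_cat last_rcons.
move=> lq pq; case/shortenP: pq lq => q pq uq sq lq.
case/lastP: q pq uq sq lq => [|rc' c'] pq uq sq.
  move=> /= E; have := U1 z; rewrite /= -!cats1 !count_cat /= E eqxx; clear; count_lia.
rewrite last_rcons => E; rewrite {}E {c'} in pq uq sq *.
(* At most one vertex, [b], is gained over [pb2] and [rc], while [z] is dropped from both [pb] and
   [ra], so the total decreases. *)
have sz : size rc' <= size pb2 + size rc + 1.
  have := uniq_leq_size (proj2 (andP uq)) sq; rewrite size_cat !size_rcons; lia.
exists z, pb1, ra2, rc'; split; last by rewrite !size_cat ?size_rcons /=; lia.
split=> //; apply/uniq_countP => x.
  by have := U1 x; rewrite /= -!cats1 !count_cat /=; count_lia.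
have := U1 x; have := U2 x; have := N x; have /uniq_countP/(_ x) := uq.
have : 0 < count_mem x (rcons rc' c) -> 0 < count_mem x (rcons pb2 b ++ rcons rc c).
  by rewrite -!mem_count; apply: sq.
rewrite Era /= -!cats1 !count_cat /=; count_lia.
Qed.

(** A common vertex of [ra] and [pa] is a new [a], with both paths cut there. *)
Lemma shorten_ra_pa : has (mem pa) ra ->
  exists a' pa' ra', fan_pair e a' b c d pa' pb pc ra' rc /\
    size pa' + size ra' < size pa + size ra.
Proof.
case: H => [[Pa Pb Pc] Ra Rc /uniq_countP U1 /uniq_countP U2].
case/hasP => z zra zpa.
case/splitPr: zpa => pa1 pa2 in Pa U1 *; case/splitPr: zra => ra1 ra2 in Ra U2 *.
move: Pa Ra; rewrite !rcons_cat !rcons_cons -!cat_rcons !cat_path.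
move=> /andP[Pa _] /andP[Ra _].
exists z, pa1, ra1; split; last by rewrite !size_cat ?size_rcons /=; lia.
split=> //; apply/uniq_countP => x.
  by have := U1 x; rewrite /= -!cats1 !count_cat /=; count_lia.
by have := U2 x; rewrite /= -!cats1 !count_cat /=; count_lia.
Qed.

(** The roles are exchanged: [pc] and [ra] are cut at a common vertex, the new [a], and [pa] and
    [rc] at another, the new [c]. *)
Lemma shorten_crossing : has (mem pc) ra -> has (mem pa) rc ->
  exists a' c' pa' pc' ra' rc', fan_pair e a' b c' d pa' pb pc' ra' rc' /\
    size pa' + size pc' + size ra' + size rc' <
    size pa + size pc + size ra + size rc.
Proof.
case: H => [[Pa Pb Pc] Ra Rc /uniq_countP U1 /uniq_countP U2].
case/hasP => w wra wpc /hasP[v vrc vpa].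
case/splitPr: vpa => pa1 pa2 in Pa U1 *; case/splitPr: wra => ra1 ra2 in Ra U2 *.
case/splitPr: wpc => pc1 pc2 in Pc U1 *; case/splitPr: vrc => rc1 rc2 in Rc U2 *.
move: Pa Ra Pc Rc; rewrite !rcons_cat !rcons_cons -!cat_rcons !cat_path.
move=> /andP[Pa _] /andP[Ra _] /andP[Pc _] /andP[Rc _].
exists w, v, pc1, pa1, ra1, rc1; split; last by rewrite !size_cat ?size_rcons /=; lia.
split=> //; apply/uniq_countP => x.
  by have := U1 x; rewrite /= -!cats1 !count_cat /=; count_lia.
by have := U2 x; rewrite /= -!cats1 !count_cat /=; count_lia.
Qed.

(** The last vertex [z] of [rc] on [pa] replaces [b]: [pa] splits at [z] into a path from [d] and a
    path to [a], the end of [rc] leads from [z] to [c], and the old [b] becomes interior to the path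
    from [d] to [a] along [pb] and [ra]. *)
Lemma one_sided_crossing :
  ~~ has (mem pb) ra -> ~~ has (mem pb) rc -> ~~ has (mem pa) ra ->
  ~~ has (mem pc) rc -> ~~ has (mem pc) ra -> has (mem pa) rc -> z4_model e.
Proof.
case: H => [[Pa Pb Pc] Ra Rc /uniq_countP U1 /uniq_countP U2].
move=> /disjoint_count0 ab /disjoint_count0 cb /disjoint_count0 aa /disjoint_count0 cc /disjoint_count0 ac.
case/has_split_last=> rc1 [z [rc2 [Erc zpa /disjoint_count0 N]]].
case/splitPr: zpa => pa1 pa2 in Pa U1 N aa *.
move: Pa; rewrite rcons_cat rcons_cons -cat_rcons cat_path last_rcons => /andP[Pa1 Pa2].
move: Rc; rewrite Erc rcons_cat rcons_cons -cat_rcons cat_path last_rcons => /andP[_ Rc2].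
exists a, z, c, d, (pb ++ b :: ra), pa1, pc, pa2, rc2; split=> //.
  by split=> //; rewrite rcons_cat rcons_cons -cat_rcons cat_path last_rcons Pb.
apply/uniq_countP => x.
move: (U1 x) (U2 x) (N x) (ab x) (cb x) (aa x) (cc x) (ac x).
rewrite Erc /= -!cats1 !count_cat /=; count_lia.
Qed.

Lemma uncrossed :
  ~~ has (mem pb) ra -> ~~ has (mem pb) rc -> ~~ has (mem pa) ra ->
  ~~ has (mem pc) rc -> ~~ has (mem pc) ra -> ~~ has (mem pa) rc -> z4_model e.
Proof.
case: H => [[Pa Pb Pc] Ra Rc /uniq_countP U1 /uniq_countP U2].
move=> /disjoint_count0 ab /disjoint_count0 cb /disjoint_count0 aa /disjoint_count0 cc /disjoint_count0 ac /disjoint_count0 ca.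
exists a, b, c, d, pa, pb, pc, ra, rc; split=> //.
apply/uniq_countP => x.
move: (U1 x) (U2 x) (ab x) (cb x) (aa x) (cc x) (ac x) (ca x).
rewrite /= -!cats1 !count_cat /=; count_lia.
Qed.

End Reductions.

Lemma fan_pair_z4_model (T : eqType) (e : rel T) a b c d pa pb pc ra rc :
  fan_pair e a b c d pa pb pc ra rc -> z4_model e.
Proof.
have [k] := ubnP (size pa + size pb + size pc + size ra + size rc).
elim: k => // k IHk in a b c d pa pb pc ra rc * => le H.
have [/(shorten_ra_pb H)|ab] := boolP (has (mem pb) ra).
  by case=> b' [pb' [ra' [rc' [/IHk + lt]]]]; apply; lia.
have [/(shorten_ra_pb (fan_pair_sym H))|cb] := boolP (has (mem pb) rc).
  by case=> b' [pb' [ra' [rc' [/IHk + lt]]]]; apply; lia.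
have [/(shorten_ra_pa H)|aa] := boolP (has (mem pa) ra).
  by case=> a' [pa' [ra' [/IHk + lt]]]; apply; lia.
have [/(shorten_ra_pa (fan_pair_sym H))|cc] := boolP (has (mem pc) rc).
  by case=> a' [pa' [ra' [/IHk + lt]]]; apply; lia.
(* Only crossings of [ra] with [pc] and of [rc] with [pa] are left: both together allow shortening,
   one alone or none gives the model. *)
have [ac|ac] := boolP (has (mem pc) ra); have [ca|ca] := boolP (has (mem pa) rc).
- case: (shorten_crossing H ac ca) => a' [c' [pa' [pc' [ra' [rc' [/IHk + lt]]]]]].
  by apply; lia.
- exact: one_sided_crossing (fan_pair_sym H) cb ab cc aa ca ac.
- exact: one_sided_crossing H ab cb aa cc ac ca.
- exact: uncrossed H ab cb aa cc ac ca.
Qed.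

(** * The reachability criterion *)

(** Deleted vertices are forbidden as heads only, so [d] always reaches itself; [u = v] encodes a
    single deletion. *)
Definition reach2 (T : finType) (e : rel T) (d u v : T) : pred T :=
  connect [rel i j | e i j && ((j != u) && (j != v))] d.

(* By Menger, there is a fan from [d] to [{x, y}] in [D - u]. *)
Definition fan2 (T : finType) (e : rel T) (d u x y : T) : bool :=
  [forall v, reach2 e d u v x || reach2 e d u v y].

(** Of the two vertices of a separator, [v] is already quantified inside [fan2], which leaves a
    single loop over [u]. *)
Definition z4_test (T : finType) (e : rel T) (d a b c : T) : bool :=
  [&& uniq [:: a; b; c; d], fan2 e b d a c &
    [forall u, [|| fan2 e d u a b, fan2 e d u a c | fan2 e d u b c]]].

Section Test.
Variables (T : finType) (e : rel T).

Lemma path_reach2 d u v x p :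
  path e d (rcons p x) -> u \notin rcons p x -> v \notin rcons p x ->
  reach2 e d u v x.
Proof.
move=> pp up vp; apply/connectP; exists (rcons p x); last by rewrite last_rcons.
elim: (rcons p x) (d) pp up vp => //= y s IHs z /andP[ezy ys].
rewrite !inE !negb_or => /andP[uy us] /andP[vy vs].
by rewrite ezy eq_sym uy eq_sym vy IHs.
Qed.

Lemma z4_model_test : z4_model e -> exists d a b c, z4_test e d a b c.
Proof.
case=> a [b [c [d [pa [pb [pc [ra [rc]]]]]]]] [[Pa Pb Pc] Ra Rc /uniq_countP U].
exists d, a, b, c; apply/and3P; split.
- by apply/uniq_countP => x; have := U x; rewrite /= !count_cat /=; count_lia.
- apply/forallP => v; apply/orP.
  have dN : (d \notin rcons ra a) && (d \notin rcons rc c).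
    rewrite !mem_count -!eqn0Ngt; have := U d.
    by rewrite -!cats1 /= !count_cat /= eqxx; count_lia.
  case/andP: dN => dra drc.
  have [vra|vra] := boolP (v \in rcons ra a); last by left; apply: path_reach2 Ra _ _.
  right; apply: path_reach2 Rc _ _ => //.
  move: vra; rewrite !mem_count -!eqn0Ngt; have := U v.
  by rewrite -!cats1 /= !count_cat /=; count_lia.
- apply/forallP => u.
  (* A deleted [v] meets at most one of two disjoint paths. *)
  have two (s t : seq T) x y :
      path e d (rcons s x) -> path e d (rcons t y) ->
      u \notin rcons s x -> u \notin rcons t y ->
      (forall v, count_mem v (rcons s x) + count_mem v (rcons t y) <= 1) ->
      fan2 e d u x y.
    move=> Ps Pt us ut st; apply/forallP => v; apply/orP.
    have [vs|vs] := boolP (v \in rcons s x); last by left; apply: path_reach2 Ps _ _.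
    right; apply: path_reach2 Pt _ _ => //.
    by have := st v; move: vs; rewrite !mem_count; clear; lia.
  (* [u] lies on at most one path of the fan from [d]; two others form the required pair. *)
  have [ua|ua] := boolP (u \in rcons pa a).
    apply/or3P; apply: Or33; apply: (two pb pc) => //.
    + move: ua; rewrite !mem_count -!eqn0Ngt; have := U u.
      by rewrite -!cats1 /= !count_cat /=; count_lia.
    + move: ua; rewrite !mem_count -!eqn0Ngt; have := U u.
      by rewrite -!cats1 /= !count_cat /=; count_lia.
    + by move=> v; have := U v; rewrite -!cats1 /= !count_cat /=; count_lia.
  have [ub|ub] := boolP (u \in rcons pb b).
    apply/or3P; apply: Or32; apply: (two pa pc) => //.
    + move: ub; rewrite !mem_count -!eqn0Ngt; have := U u.
      by rewrite -!cats1 /= !count_cat /=; count_lia.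
    + by move=> v; have := U v; rewrite -!cats1 /= !count_cat /=; count_lia.
  apply/or3P; apply: Or31; apply: (two pa pb) => //.
  by move=> v; have := U v; rewrite -!cats1 /= !count_cat /=; count_lia.
Qed.

Lemma card_lt_sub2 (U : {set T}) (u0 : T) : #|U| < 3 ->
  exists u v, {subset U <= [:: u; v]}.
Proof.
rewrite cardE => lt3; exists (nth u0 (enum U) 0), (nth u0 (enum U) 1) => x.
rewrite -mem_enum; case: (enum U) lt3 => [|y [|z [|]]] //= _; rewrite !inE //.
by move=> ->.
Qed.

Lemma reach2_connect d u v x (U : {set T}) :
  {subset U <= [:: u; v]} -> reach2 e d u v x ->
  connect [rel i j | e i j && (j \notin U)] d x.
Proof.
move=> sU; apply: connect_sub => i j /and3P[eij ju jv]; apply: connect1 => /=.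
by rewrite eij; apply/negP => /sU; rewrite !inE (negPf ju) (negPf jv).
Qed.

Lemma z4_test_model d a b c : z4_test e d a b c -> z4_model e.
Proof.
case/and3P=> uq /forallP F2 /forallP F3.
move: (uq); rewrite /= !inE !negb_or.
case/and4P=> /and3P[ab ac ad] /andP[bc bd] cd _.
have [|U|p [pP pD]] := @fan_menger T e d [set a; b; c].
- by rewrite !inE !negb_or !(eq_sym d) ad bd cd.
- rewrite -setUA !cardsU1 cards1 !inE negb_or ab ac bc => /(card_lt_sub2 d).
  case=> u [v sU]; have := F3 u.
  by case/or3P=> /forallP/(_ v)/orP[] /(reach2_connect sU) h;
    [exists a|exists b|exists a|exists c|exists b|exists c]; rewrite // !inE eqxx ?orbT.
(* Removing the arcs into [d] keeps the second fan off [d]. *)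
have [|U|q [qP qD]] := @fan_menger T [rel i j | e i j && (j != d)] b [set a; c].
- by rewrite !inE negb_or bc eq_sym ab.
- rewrite cards2 ac => cU.
  (* [U] has at most one element; [d] is chosen for [v] when [U] holds nothing else. *)
  have [v sU] : exists v, {subset U <= [:: v]}.
    have /card_lt_sub2 : #|d |: U| < 3 by rewrite cardsU1; lia.
    move=> /(_ d)[u [v sU]].
    have [Ud|/subsetPn[w]] := boolP (U \subset [set d]).
      by exists d => w /(subsetP Ud); rewrite !inE.
    move=> wU _; exists w => z zU.
    by have := cU; rewrite (cardsD1 w) wU ltnS ltnS leqn0 cards_eq0 =>
      /eqP/setP/(_ z); rewrite !inE zU andbT => /negbFE.
  have R x : reach2 e b d v x ->
      connect [rel i j | (e i j && (j != d)) && (j \notin U)] b x.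
    apply: connect_sub => i j /and3P[eij jd jv]; apply: connect1 => /=.
    by rewrite eij jd; apply/negP => /sU; rewrite !inE (negPf jv).
  by case/orP: (F2 v) => /R h; [exists a|exists c]; rewrite // !inE eqxx ?orbT.
have aX : a \in [set a; b; c] by rewrite !inE eqxx.
have bX : b \in [set a; b; c] by rewrite !inE eqxx ?orbT.
have cX : c \in [set a; b; c] by rewrite !inE eqxx ?orbT.
have aY : a \in [set a; c] by rewrite !inE eqxx.
have cY : c \in [set a; c] by rewrite !inE eqxx ?orbT.
have [Pa Ua] := pP a aX; have [Pb Ub] := pP b bX; have [Pc Uc] := pP c cX.
have [Ra Va] := qP a aY; have [Rc Vc] := qP c cY.
have dis (s t : seq T) x y : uniq (x :: s) -> uniq (y :: t) ->
    (forall z, z \in s -> z \in t -> False) ->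
    forall z, count_mem z s + count_mem z t <= 1.
  move=> /andP[_ us] /andP[_ ut] st z; rewrite !count_uniq_mem //.
  by have := st z; do 2![case: (_ \in _)] => // /(_ isT isT).
have PD x y : x \in [set a; b; c] -> y \in [set a; b; c] -> x != y ->
    forall z, count_mem z (rcons (p x) x) + count_mem z (rcons (p y) y) <= 1.
  move=> xX yX xy; have [_ ux] := pP x xX; have [_ uy] := pP y yX.
  by apply: dis ux uy _ => z zx zy; case/eqP: xy; apply: pD zx zy.
have RD : forall z, count_mem z (rcons (q a) a) + count_mem z (rcons (q c) c) <= 1.
  by apply: dis Va Vc _ => z zx zy; case/eqP: ac; apply: qD zx zy.
have sub x s : path [rel i j | e i j && (j != d)] x s -> path e x s /\ d \notin s.
  elim: s x => //= y s IHs x /andP[/andP[exy yd] /IHs[ps ds]].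
  by rewrite exy inE negb_or eq_sym yd.
have [Ra' dRa] := sub _ _ Ra; have [Rc' dRc] := sub _ _ Rc.
apply: (@fan_pair_z4_model _ e a b c d (p a) (p b) (p c) (q a) (q c)).
split=> //; apply/uniq_countP => x.
  have /uniq_countP/(_ x) := Ua; have /uniq_countP/(_ x) := Ub.
  have /uniq_countP/(_ x) := Uc.
  have := PD a b aX bX ab x; have := PD a c aX cX ac x; have := PD b c bX cX bc x.
  rewrite /= !count_cat; move: (count_mem x _) (count_mem x _) (count_mem x _).
  by move: (nat_of_bool _) => k; clear; case=> [|i] [|j] [|l]; lia.
have := RD x; move: dRa dRc bd; rewrite !mem_count -!eqn0Ngt.
have /uniq_countP/(_ x) := Va; have /uniq_countP/(_ x) := Vc.
rewrite /= !count_cat; case: (eqVneq d x) => [->|_] /=; last by count_lia.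
by move=> _ _ /eqP-> /eqP-> /negPf->.
Qed.

End Test.

(** * Subdivisions and adjacency lists *)

Lemma path_zip (T : eqType) (e : rel T) (L : seq (T * T)) x s y :
  path e x (rcons s y) -> {subset zip (x :: s) (rcons s y) <= L} ->
  path [rel u v | e u v && ((u, v) \in L)] x (rcons s y).
Proof.
elim: s x => [|z s IHs] x /= /andP[exz ps] sL.
  by rewrite exz sL ?inE.
rewrite exz sL ?inE ?eqxx //=; apply: IHs => // p ps'.
by apply: sL; rewrite inE ps' orbT.
Qed.

(** Branch vertices and paths are placed directly in the host [D], with no intermediate digraph. *)
Definition subdivision_model (F D : digraph) (f : F -> D)
    (P : F -> F -> seq D) : Prop :=
  [/\ injective f,
      forall x y, is_arc x y ->
        [/\ path (@is_arc D) (f x) (rcons (P x y) (f y)),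
            uniq (P x y) & forall z, f z \notin P x y]
    & forall x y x' y', is_arc x y -> is_arc x' y' -> (x, y) <> (x', y') ->
        [disjoint P x y & P x' y']].

Lemma disjoint_map (T T' : finType) (h : T -> T') (s t : seq T) :
  injective h -> [disjoint map h s & map h t] = [disjoint s & t].
Proof.
move=> hi; rewrite !disjoint_has has_map; congr (~~ _); apply: eq_has => x /=.
by rewrite mem_map.
Qed.

Lemma zip_map_map (S T : Type) (f : S -> T) (s t : seq S) :
  zip (map f s) (map f t) = map (fun p => (f p.1, f p.2)) (zip s t).
Proof. by elim: s t => [|x s IHs] [|y t] //=; rewrite IHs. Qed.

(** From right to left, the subdivision is the digraph formed by exactly the vertices and arcs of
    the chosen paths. *)
Lemma has_subdivisionP (F D : digraph) :
  has_subdivision F D <->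
  exists (f : F -> D) (P : F -> F -> seq D), subdivision_model f P.
Proof.
split=> [[S [[f [P [fi fP PP _ _]]] [h [hi hh]]]]|[f [P [fi fP PP]]]].
  exists (h \o f), (fun x y => map h (P x y)); split.
  - exact: inj_comp.
  - move=> x y /fP[pxy uxy nxy]; split.
    + rewrite /= -map_rcons path_map.
      by apply: sub_path pxy => u v /=; apply: hh.
    + by rewrite map_inj_uniq.
    + by move=> z; rewrite /= mem_map.
  - by move=> x y x' y' xy xy' ne; rewrite disjoint_map // PP.
pose V v := [exists x, v == f x] || [exists x, exists y, is_arc x y && (v \in P x y)].
pose L x y := zip (f x :: P x y) (rcons (P x y) (f y)).
pose E (u v : {v | V v}) := is_arc (val u) (val v) &&
  [exists x, exists y, is_arc x y && ((val u, val v) \in L x y)].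
have Eirr : irreflexive E by move=> u; rewrite /E arc_irrefl.
have Vf x : V (f x) by apply/orP; left; apply/existsP; exists x.
have VP x y : is_arc x y -> all V (P x y).
  move=> xy; apply/allP => v vP; apply/orP; right.
  by apply/existsP; exists x; apply/existsP; exists y; rewrite xy.
pose f' x : {v | V v} := Sub (f x) (Vf x).
(* [insub] discards nothing from the path of an arc, as all its vertices satisfy [V]. *)
pose P' x y : seq {v | V v} := pmap insub (P x y).
have vP' x y : is_arc x y -> map val (P' x y) = P x y.
  move=> /VP/all_filterP fE; rewrite /P' pmap_filter; last exact: insubK.
  by rewrite -[RHS]fE; apply: eq_filter => v; rewrite isSome_insub.
have vr x y : is_arc x y -> map val (rcons (P' x y) (f' y)) = rcons (P x y) (f y).
  by move=> xy; rewrite map_rcons vP' //= SubK.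
exists (Digraph Eirr); split; last first.
  by exists val; split=> [|u v /andP[]] //; apply: val_inj.
exists f', P'; split.
- by move=> x y /(congr1 val); rewrite !SubK => /fi.
- move=> x y xy; have [pxy uxy nxy] := fP x y xy; split.
  + have := @path_zip _ _ (L x y) _ _ _ pxy (fun _ => id).
    rewrite -(vr x y xy) -[f x]/(val (f' x)) path_map.
    apply: sub_path => u v /= /andP[euv uvL]; rewrite /E euv /=.
    by apply/existsP; exists x; apply/existsP; exists y; rewrite xy.
  + by rewrite -(map_inj_uniq val_inj) vP'.
  + by move=> z; rewrite -(mem_map val_inj) vP' //; apply: nxy.
- move=> x y x' y' xy xy' ne.
  by rewrite -(disjoint_map _ _ val_inj) !vP' ?PP.
- case=> v Vv; case/orP: (Vv) => [/existsP[x /eqP vx]|].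
    by left; exists x; apply: val_inj.
  case/existsP=> x /existsP[y /andP[xy vP]]; right; exists x, y; split=> //.
  by rewrite -(mem_map val_inj) vP'.
- move=> u v /andP[_ /existsP[x /existsP[y /andP[xy uvL]]]]; exists x, y; split=> //.
  have -> : ((u, v) \in zip (f' x :: P' x y) (rcons (P' x y) (f' y))) =
      ((val u, val v) \in L x y); last by [].
  rewrite /L -vr // -{1}(vP' x y) // -[f x]/(val (f' x)) -map_cons zip_map_map.
  pose vv (p : {v | V v} * {v | V v}) := (val p.1, val p.2).
  rewrite -[(val u, val v)]/(vv (u, v)) mem_map //.
  by move=> [? ?] [? ?] [/val_inj-> /val_inj->].
Qed.

Lemma has_subdivision_z4 (D : digraph) :
  has_subdivision Z4 D <-> z4_model (@is_arc D).
Proof.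
pose v0 : Z4 := @Ordinal 4 0 isT; pose v1 : Z4 := @Ordinal 4 1 isT.
pose v2 : Z4 := @Ordinal 4 2 isT; pose v3 : Z4 := @Ordinal 4 3 isT.
have A30 : @is_arc Z4 v3 v0 by []. have A31 : @is_arc Z4 v3 v1 by [].
have A32 : @is_arc Z4 v3 v2 by []. have A10 : @is_arc Z4 v1 v0 by [].
have A12 : @is_arc Z4 v1 v2 by [].
rewrite has_subdivisionP; split=> [[f [P [fi fP PP]]]|].
  exists (f v0), (f v1), (f v2), (f v3).
  exists (P v3 v0), (P v3 v1), (P v3 v2), (P v1 v0), (P v1 v2).
  have [? u30 n30] := fP _ _ A30; have [? u31 n31] := fP _ _ A31.
  have [? u32 n32] := fP _ _ A32; have [? u10 n10] := fP _ _ A10.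
  have [? u12 n12] := fP _ _ A12; split=> //.
  have -> : [:: f v0; f v1; f v2; f v3] = map f [:: v0; v1; v2; v3] by [].
  rewrite !cat_uniq !has_cat !negb_or map_inj_uniq // u30 u31 u32 u10 u12 /=.
  have nf x y : is_arc x y -> ~~ has (mem (map f [:: v0; v1; v2; v3])) (P x y).
    move=> xy; have [_ _ nxy] := fP x y xy; apply/hasPn => z zP; apply/negP => /mapP[t _ E].
    by have := nxy t; rewrite -E zP.
  have nP x y x' y' : is_arc x y -> is_arc x' y' -> (x, y) <> (x', y') ->
      ~~ has (mem (P x y)) (P x' y').
    by move=> xy xy' ne; rewrite -disjoint_has disjoint_sym PP.
  by rewrite !nf // !nP.
case=> a [b [c [d [pa [pb [pc [ra [rc]]]]]]]] [[Pa Pb Pc] Ra Rc U].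
exists (fun x : Z4 => nth d [:: a; b; c; d] (x : 'I_4)).
(* Rows are indexed by tails and columns by heads; missing entries default to the empty path. *)
pose tab := [:: [::]; [:: ra; [::]; rc]; [::]; [:: pa; pb; pc]].
exists (fun x y : Z4 => nth [::] (nth [::] tab (x : 'I_4)) (y : 'I_4)).
have arcE x y : @is_arc Z4 x y ->
    (x, y) \in [:: (v3, v0); (v3, v1); (v3, v2); (v1, v0); (v1, v2)].
  by case: x y => [[|[|[|[|x]]]] ?] [[|[|[|[|y]]]] ?].
move/uniq_countP: U => U.
have notin (s t : seq D) : (forall x, count_mem x s + count_mem x t <= 1) ->
    forall x, x \in s -> x \notin t.
  by move=> st x; rewrite !mem_count; have := st x; clear; lia.
split.
- move=> x y /eqP; rewrite nth_uniq //; first by move/eqP/val_inj.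
  by apply/uniq_countP => z; have := U z; rewrite /= !count_cat; count_lia.
- move=> x y /arcE; rewrite !inE.
  do 4?[case/orP]; move=> /eqP[-> ->] /=; split=> //;
  first [by apply/uniq_countP => z; have := U z; rewrite /= !count_cat; count_lia
        |move=> z; apply: (notin [:: a; b; c; d]); last exact: mem_nth;
         by move=> t; have := U t; rewrite /= !count_cat /=; count_lia].
- move=> x y x' y' /arcE + /arcE; rewrite !inE.
  do 4?[case/orP]; move=> /eqP[-> ->]; do 4?[case/orP]; move=> /eqP[-> ->] //= _;
  rewrite disjoint_has; apply/hasPn => z; apply: notin => t; have := U t;
  by rewrite /= !count_cat /=; count_lia.
Qed.

(** Applied to a vertex numbering and to its inverse, this transfers models between [D] and its
    adjacency lists. *)
Lemma z4_model_homo (T T' : eqType) (e : rel T) (e' : rel T') (h : T -> T') :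
  injective h -> {homo h : x y / e x y >-> e' x y} -> z4_model e -> z4_model e'.
Proof.
move=> hi hh [a [b [c [d [pa [pb [pc [ra [rc [[Pa Pb Pc] Ra Rc U]]]]]]]]]].
exists (h a), (h b), (h c), (h d), (map h pa), (map h pb), (map h pc), (map h ra), (map h rc).
have hp x y s : path e x (rcons s y) -> path e' (h x) (rcons (map h s) (h y)).
  by rewrite -map_rcons path_map; apply: sub_path => u v /hh.
split; [split| | |]; try exact: hp.
by rewrite -!map_cat -[_ :: _]/(map h [:: a; b; c; d]) -map_cat map_inj_uniq.
Qed.

Definition adj_rel (adj : seq (seq nat)) (n : nat) : rel 'I_n :=
  fun i j : 'I_n => val j \in nth [::] adj i.

Lemma adjacency_z4_model (D : digraph) (adj : seq (seq nat)) :
  adjacency_lists D adj ->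
  z4_model (@is_arc D) <-> z4_model (@adj_rel adj (nvertices D)).
Proof.
case=> num [numi _ adjP]; split; first apply: (z4_model_homo (h := num)) => //.
  by move=> u v uv; rewrite /adj_rel (perm_mem (adjP u)); apply/mapP; exists v; rewrite ?mem_enum.
have [|g gK Kg] := inj_card_bij numi; first by rewrite card_ord.
apply: (z4_model_homo (h := g)); first exact: can_inj Kg.
move=> i j; rewrite /adj_rel -{1}[i]Kg (perm_mem (adjP _)) => /mapP[v].
by rewrite mem_enum => giv /val_inj->; rewrite gK.
Qed.

(** * Total correctness of RAM programs *)

(** A Hoare triple for total correctness, with [T] only an upper bound on the time. *)
Definition runs (W : nat) (c : cmd) (T : nat) (s : state) (Q : state -> Prop) :
    Prop :=
  exists t s', [/\ exec W c s t s', t <= T & Q s'].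

Fixpoint wregs (c : cmd) : seq nat :=
  match c with
  | Skip | Write _ _ _ => [::]
  | Assign r _ => [:: r]
  | Seq c1 c2 | If _ c1 c2 => wregs c1 ++ wregs c2
  | While _ c => wregs c
  end.

Fixpoint warrs (c : cmd) : seq nat :=
  match c with
  | Skip | Assign _ _ => [::]
  | Write a _ _ => [:: a]
  | Seq c1 c2 | If _ c1 c2 => warrs c1 ++ warrs c2
  | While _ c => warrs c
  end.

(* [s'] differs from [s] at most in the registers [R] and the arrays [A]. *)
Definition same (R A : seq nat) (s s' : state) : Prop :=
  (forall r, r \notin R -> reg s' r = reg s r) /\
  (forall a, a \notin A -> forall i, Defs.mem s' a i = Defs.mem s a i).

Lemma same_refl R A s : same R A s s.
Proof. by []. Qed.

Lemma same_sub R A R' A' s s' :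
  {subset R <= R'} -> {subset A <= A'} -> same R A s s' -> same R' A' s s'.
Proof.
move=> sR sA [eR eA]; split=> [r rR|a aA].
  by apply: eR; apply: contra rR; apply: sR.
by apply: eA; apply: contra aA; apply: sA.
Qed.

Lemma same_trans R A s1 s2 s3 :
  same R A s1 s2 -> same R A s2 s3 -> same R A s1 s3.
Proof.
move=> [r12 a12] [r23 a23]; split=> [r rR|a aA i].
  by rewrite r23 // r12.
by rewrite a23 // a12.
Qed.

Lemma same_put_reg (R A : seq nat) s r v : r \in R -> same R A s (put_reg s r v).
Proof. by move=> rR; split=> //= r' r'R; case: eqP => // E; rewrite E rR in r'R. Qed.

Lemma same_put_mem (R A : seq nat) s a i v : a \in A -> same R A s (put_mem s a i v).
Proof. by move=> aA; split=> //= a' a'A i'; case: eqP => // E; rewrite E aA in a'A. Qed.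

(** The frame rule, which frees loop invariants from mentioning what the program text never
    writes. *)
Lemma exec_same W c s t s' : exec W c s t s' -> same (wregs c) (warrs c) s s'.
Proof.
have sl (T : eqType) (x y : seq T) : {subset x <= x ++ y}.
  by move=> z zx; rewrite mem_cat zx.
have sr (T : eqType) (x y : seq T) : {subset y <= x ++ y}.
  by move=> z zx; rewrite mem_cat zx orbT.
elim=> {c s t s'} [s|s r e _|s a i e _ _|c1 c2 s t1 s1 t2 s2 _ I1 _ I2
    |e c1 c2 s t s' _ _ I|e c1 c2 s t s' _ _ I|e c s t1 s1 t2 s2 _ _ I1 _ I2|e c s _].
- exact: same_refl.
- by apply: same_put_reg; rewrite inE.
- by apply: same_put_mem; rewrite inE.
- exact: same_trans (same_sub (sl _ _ _) (sl _ _ _) I1) (same_sub (sr _ _ _) (sr _ _ _) I2).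
- exact: same_sub (sl _ _ _) (sl _ _ _) I.
- exact: same_sub (sr _ _ _) (sr _ _ _) I.
- exact: same_trans I2.
- exact: same_refl.
Qed.

Lemma runs_same W c T s Q : runs W c T s Q ->
  runs W c T s (fun s' => Q s' /\ same (wregs c) (warrs c) s s').
Proof.
by case=> t [s' [ex le q]]; exists t, s'; split=> //; split=> //; apply: exec_same ex.
Qed.

Lemma runs_le W c T T' s Q : runs W c T s Q -> T <= T' -> runs W c T' s Q.
Proof. by case=> t [s' [ex le q]] lt; exists t, s'; split=> //; apply: leq_trans lt. Qed.

Lemma runs_imp W c T s (Q Q' : state -> Prop) :
  (forall s', Q s' -> Q' s') -> runs W c T s Q -> runs W c T s Q'.
Proof. by move=> QQ [t [s' [ex le /QQ q]]]; exists t, s'. Qed.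

Lemma runs_skip W s (Q : state -> Prop) : Q s -> runs W Skip 1 s Q.
Proof. by move=> q; exists 1, s; split=> //; apply: ExecSkip. Qed.

Lemma runs_assign W r e s (Q : state -> Prop) :
  eval s e <= W -> Q (put_reg s r (eval s e)) ->
  runs W (Assign r e) (cost e).+1 s Q.
Proof. by move=> le q; exists (cost e).+1; eexists; split; [apply: ExecAssign| |exact: q]. Qed.

Lemma runs_write W a i e s (Q : state -> Prop) :
  eval s i <= W -> eval s e <= W -> Q (put_mem s a (eval s i) (eval s e)) ->
  runs W (Write a i e) (cost i + cost e).+1 s Q.
Proof.
by move=> li le q; exists (cost i + cost e).+1; eexists; split;
  [apply: ExecWrite| |exact: q].
Qed.

Lemma runs_seq W c1 c2 T1 T2 s (Q1 Q : state -> Prop) :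
  runs W c1 T1 s Q1 -> (forall s1, Q1 s1 -> runs W c2 T2 s1 Q) ->
  runs W (Seq c1 c2) (T1 + T2) s Q.
Proof.
case=> t1 [s1 [e1 l1 q1]] /(_ _ q1)[t2 [s2 [e2 l2 q2]]].
by exists (t1 + t2), s2; split; [apply: ExecSeq e1 e2|apply: leq_add|].
Qed.

(** Adding the branch times instead of taking their maximum loses only a constant factor. *)
Lemma runs_if W e c1 c2 T1 T2 s (Q : state -> Prop) :
  (eval s e != 0 -> runs W c1 T1 s Q) -> (eval s e = 0 -> runs W c2 T2 s Q) ->
  runs W (If e c1 c2) (cost e + (T1 + T2)).+1 s Q.
Proof.
move=> h1 h2; have [e0|e0] := posnP (eval s e).
  have [t [s' [ex le q]]] := h2 e0; exists (cost e + t).+1, s'; split=> //.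
    exact: ExecIfFalse.
  by rewrite ltnS leq_add2l; lia.
have [|t [s' [ex le q]]] := h1; first by rewrite -lt0n.
exists (cost e + t).+1, s'; split=> //; first by apply: ExecIfTrue; rewrite -?lt0n.
by rewrite ltnS leq_add2l; lia.
Qed.

Definition For (r b : nat) (body : cmd) : cmd :=
  Seq (Assign r (Const 0))
      (While (Op OpLt (Reg r) (Reg b))
             (Seq body (Assign r (Op OpAdd (Reg r) (Const 1))))).

(** Each round adds 4 for the test and 4 for the increment; the final 6 is 2 for the initialisation
    and 4 for the failing test. *)
Definition loop_time (N T : nat) : nat := N * (T + 8) + 6.

(** The invariant is restored only after the increment, hence [put_reg s'' r k.+1] in the premise on
    the body. *)
Lemma runs_for W r b N body T (I : nat -> state -> Prop) s :
  r \notin wregs body -> b \notin r :: wregs body -> N <= W -> reg s b = N ->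
  I 0 (put_reg s r 0) ->
  (forall k s', k < N -> same (r :: wregs body) (warrs body) s s' ->
     reg s' r = k -> I k s' ->
     runs W body T s' (fun s'' => I k.+1 (put_reg s'' r k.+1))) ->
  runs W (For r b body) (loop_time N T) s (I N).
Proof.
move=> rb bb NW bN I0 step.
have key j k s' : j + k = N -> same (r :: wregs body) (warrs body) s s' ->
    reg s' r = k -> I k s' ->
    exists t s'', [/\ exec W (While (Op OpLt (Reg r) (Reg b))
             (Seq body (Assign r (Op OpAdd (Reg r) (Const 1))))) s' t s'',
          t <= j * (T + 8) + 4 & I N s''].
  elim: j k s' => [|j IHj] k s' jk ss rk Ik.
    exists 4, s'; split=> //; last by rewrite -jk.
    by apply: ExecWhileFalse; rewrite /= rk ss.1 // bN -jk ltnn.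
  have kN : k < N by lia.
  have [t1 [s1 [ex1 l1 [q1 same1]]]] := runs_same (step k s' kN ss rk Ik).
  have r1 : reg s1 r = k by rewrite same1.1.
  have ss2 : same (r :: wregs body) (warrs body) s (put_reg s1 r k.+1).
    apply: same_trans ss _; apply: same_trans (same_put_reg _ _ _ (mem_head _ _)).
    by apply: same_sub same1 => // z zb; rewrite inE zb orbT.
  have [||t2 [s2 [ex2 l2 q2]]] := IHj k.+1 _ _ ss2 _ q1; first by lia.
    by rewrite /= eqxx.
  exists (3 + (t1 + 4) + t2).+1, s2; split=> //; last by lia.
  apply: (@ExecWhileTrue W (Op OpLt (Reg r) (Reg b)) _ _ _ (put_reg s1 r k.+1)) => //.
    by rewrite /= rk ss.1 // bN kN.
  have E : eval s1 (Op OpAdd (Reg r) (Const 1)) = k.+1 by rewrite /= r1 addn1.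
  by rewrite -E; apply: ExecSeq ex1 _; apply: ExecAssign; rewrite E; lia.
have [||t [s' [ex le q]]] := key N 0 (put_reg s r 0) (addn0 N) _ _ I0.
- by apply: same_put_reg; rewrite mem_head.
- by rewrite /= eqxx.
exists (2 + t), s'; split=> //; last by rewrite /loop_time; lia.
by apply: ExecSeq ex; apply: (@ExecAssign W s r (Const 0)).
Qed.

(** * The program *)

(* Registers 2 to 5 hold the vertices of the outer loops (in [reach_block],
   register 5 is the first cell of the current row of array 3) and register 7
   the vertex or arc of the innermost loop.  Array 2 holds the tails of the arcs,
   array 3 the values of [reach2] and array 4 those of [fan2], a quadruple of
   vertices being read as a number in base [n]. *)
Definition nest (rs : seq nat) (body : cmd) : cmd :=
  foldr (fun r c => For r 0 c) body rs.

Definition loop_index (n : nat) (s : state) : nat -> seq nat -> nat :=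
  foldl (fun q r => q * n + reg s r).

Lemma mem_wregs_nest rs body : wregs (nest rs body) =i rs ++ wregs body.
Proof.
elim: rs => //= r rs IHrs x; rewrite !inE !mem_cat IHrs !inE mem_cat.
by case: (x == r) => //=; rewrite orbF.
Qed.

Lemma warrs_nest rs body : warrs (nest rs body) = warrs body.
Proof. by elim: rs => //= r rs ->; rewrite cats0. Qed.

(** The nest is treated as one loop over its counters read in base [n], with [q0] standing for the
    digits of the enclosing loops. The invariant has to tolerate writes to the counters, since inner
    ones are reset. *)
Lemma runs_nest W n body T (I : nat -> state -> Prop) rs q0 s :
  uniq rs -> 0 \notin rs -> 0 \notin wregs body ->
  (forall r, r \in rs -> r \notin wregs body) ->
  n <= W -> reg s 0 = n ->
  (forall r k q s', r \in rs -> I q s' -> I q (put_reg s' r k)) ->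
  (forall s', same (rs ++ wregs body) (warrs body) s s' ->
     (forall r, r \in rs -> reg s' r < n) ->
     I (loop_index n s' q0 rs) s' ->
     runs W body T s' (I (loop_index n s' q0 rs).+1)) ->
  I (q0 * n ^ size rs) s ->
  runs W (nest rs body) (iter (size rs) (loop_time n) T) s
    (I (q0.+1 * n ^ size rs)).
Proof.
move=> + + b0 + nW; elim: rs q0 s => [|r rs IHrs] q0 s.
  by move=> _ _ _ sn _ step; rewrite !muln1 => I0; apply: step.
case/andP=> rrs urs; rewrite inE negb_or => /andP[r0 z0] rb sn ins step I0 /=.
have rn : r \notin wregs (nest rs body).
  by rewrite mem_wregs_nest mem_cat negb_or rrs rb ?mem_head.
apply: (@runs_imp _ _ _ _ (fun s' => I ((q0 * n + n) * n ^ size rs) s')).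
  by move=> s'; rewrite expnS mulnA mulSnr.
apply: (@runs_for _ _ _ _ _ _ (fun k s' => I ((q0 * n + k) * n ^ size rs) s')) => //.
- by rewrite inE negb_or r0 mem_wregs_nest mem_cat negb_or z0.
- by apply: ins; [rewrite mem_head | rewrite addn0 -mulnA -expnS].
move=> k s' kn ss rk Ik.
have {}ss : same (r :: rs ++ wregs body) (warrs body) s s'.
  rewrite warrs_nest in ss; apply: same_sub ss => // z.
  by rewrite !inE mem_wregs_nest.
apply: (@runs_imp _ _ _ _ (I ((q0 * n + k).+1 * n ^ size rs))).
  by move=> s'' H; apply: ins; rewrite ?mem_head // addnS.
apply: IHrs => //.
- by move=> z zrs; apply: rb; rewrite inE zrs orbT.
- by rewrite ss.1 // inE negb_or r0 mem_cat negb_or z0.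
- by move=> z j q s2 zrs; apply: ins; rewrite inE zrs orbT.
move=> s2 ss2 bnd.
have rk2 : reg s2 r = k by rewrite ss2.1 // mem_cat negb_or rrs rb ?mem_head.
have := step s2; rewrite /loop_index /= rk2; apply.
- apply: same_trans ss _; apply: same_sub ss2 => // z zz.
  by rewrite inE zz orbT.
- by move=> z; rewrite inE => /orP[/eqP->|/bnd//]; rewrite rk2.
Qed.

Lemma digit_lt n q Q x : q < Q -> x < n -> q * n + x < Q * n.
Proof. by move=> qQ xn; apply: (@leq_trans (q.+1 * n)); [lia | rewrite leq_mul2r qQ orbT]. Qed.

Lemma digit_inj n q q' x x' : x < n -> x' < n ->
  q * n + x = q' * n + x' -> q = q' /\ x = x'.
Proof.
move=> xn xn' E; have E2 := congr1 (modn^~ n) E; have := congr1 (divn^~ n) E.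
rewrite /= !divnMDl ?divn_small //; try by lia.
Qed.

(** * The table of reachability with two deleted vertices *)

Section Search.
Variables (n m W : nat) (e : rel 'I_n) (src tgt : nat -> nat).
Hypothesis srcP : forall k, k < m -> src k < n.
Hypothesis tgtP : forall k, k < m -> tgt k < n.
Hypothesis arcP : forall i j : 'I_n,
  reflect (exists2 k, k < m & src k = i /\ tgt k = j) (e i j).
Hypothesis nW : n <= W.
Hypothesis mW : m <= W.
Hypothesis W1 : 0 < W.
Hypothesis n4W : n ^ 4 <= W.

Definition env (s : state) : Prop :=
  [/\ reg s 0 = n, reg s 1 = m, forall k, k < m -> Defs.mem s 1 k = tgt k
    & forall k, k < m -> Defs.mem s 2 k = src k].

Lemma env_same R A s s' : same R A s s' ->
  0 \notin R -> 1 \notin R -> 1 \notin A -> 2 \notin A -> env s -> env s'.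
Proof.
move=> [eR eA] r0 r1 a1 a2 [n0 m1 t1 s2]; split; rewrite ?eR // => k km.
  by rewrite eA // t1.
by rewrite eA // s2.
Qed.

(** A Bellman-Ford relaxation of the arc numbered by register 7; the sum of the two equality tests
    is a disjunction. *)
Definition relax : cmd :=
  If (Read 3 (Op OpAdd (Reg 5) (Read 2 (Reg 7))))
     (If (Op OpAdd (Op OpEq (Read 1 (Reg 7)) (Reg 3))
                   (Op OpEq (Read 1 (Reg 7)) (Reg 4)))
         Skip
         (Write 3 (Op OpAdd (Reg 5) (Read 1 (Reg 7))) (Const 1)))
     Skip.

(** [n] rounds over all arcs suffice, because a simple path has fewer than [n] arcs. *)
Definition reach_block : cmd :=
  Seq (Assign 5 (Op OpMul (Op OpAdd (Op OpMul (Op OpAdd (Op OpMul (Reg 2) (Reg 0))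
                  (Reg 3)) (Reg 0)) (Reg 4)) (Reg 0)))
      (Seq (Write 3 (Op OpAdd (Reg 5) (Reg 2)) (Const 1))
           (For 6 0 (For 7 1 relax))).

Section Block.
Variables (d u v : 'I_n) (B : nat).
Hypothesis Bn : B < n ^ 3.
Let r := [rel i j | e i j && ((j != u) && (j != v))].

Lemma addrW x : x < n -> B * n + x <= W.
Proof.
move=> xn; apply: leq_trans n4W; rewrite (expnSr n 3); apply: ltnW.
exact: digit_lt.
Qed.

(** The soundness half of the search invariant; completeness is tracked apart, by the length of
    paths from [d]. *)
Definition partial (s0 s : state) : Prop :=
  [/\ forall x : 'I_n, Defs.mem s 3 (B * n + x) != 0 -> reach2 e d u v x,
      forall x : 'I_n, Defs.mem s 3 (B * n + x) <= 1
    & forall j, (j < B * n) || (B.+1 * n <= j) ->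
        Defs.mem s 3 j = Defs.mem s0 3 j].

Definition loaded (s : state) : Prop :=
  [/\ env s, reg s 5 = B * n, reg s 3 = u & reg s 4 = v].

Lemma loaded_same R s s' : same R [:: 3] s s' ->
  [&& 0 \notin R, 1 \notin R, 3 \notin R, 4 \notin R & 5 \notin R] ->
  loaded s -> loaded s'.
Proof.
move=> ss /and5P[r0 r1 r3 r4 r5] [en e5 e3 e4].
by split; [apply: env_same ss _ _ _ _ en | rewrite ss.1..].
Qed.

Definition marked (s : state) (x : nat) : bool := Defs.mem s 3 (B * n + x) != 0.

Lemma runs_relax s0 s k : loaded s -> reg s 7 = k -> k < m -> partial s0 s ->
  runs W relax 40 s (fun s' => [/\ partial s0 s',
    forall x, marked s x -> marked s' x
  & marked s (src k) -> tgt k != u -> tgt k != v -> marked s' (tgt k)]).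
Proof.
move=> [[n0 m1 t1 s2] e5 e3 e4] e7 km pt.
apply: runs_le (runs_if (T1 := 25) (T2 := 1) _ _) _ => //=;
  rewrite e5 e7 s2 // => M; last first.
  by apply: runs_skip; split=> //; rewrite /marked M eqxx.
apply: runs_le (runs_if (T1 := 1) (T2 := 8) _ _) _ => //=;
  rewrite e7 e3 e4 t1 // => C.
  by apply: runs_skip; split=> // _ /negPf tu /negPf tv; rewrite tu tv in C.
have [tu tv] : tgt k != u /\ tgt k != v.
  by split; apply/negP => E; rewrite E ?addn1 in C.
have tn := tgtP km; case: pt => p1 p2 p3.
apply: runs_le (runs_write _ _ _) _ => //=; rewrite ?e5 ?e7 ?t1 ?addrW //.
split=> [|x|_ _ _]; last 2 first.
- by rewrite /marked /=; case: ifP.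
- by rewrite /marked /= eqxx.
split=> [x|x|j jB] /=.
- rewrite eqn_add2l; case: (nat_of_ord x =P tgt k) => [E _|_]; last exact: p1.
  have sr : reach2 e d u v (Ordinal (srcP km)) by apply: p1.
  apply: connect_trans sr (connect1 _) => /=; apply/andP; split.
    by apply/arcP; exists k.
  by rewrite -!val_eqE /= E tu.
- by case: ifP.
- by rewrite p3 //; case: eqP => // E; lia.
Qed.

(** A path of at most [k.+1] arcs is a path of at most [k] arcs, whose end was marked before the
    round, followed by an arc relaxed during the round. *)
Lemma runs_round s0 s k : loaded s -> partial s0 s ->
  (forall p, path r d p -> size p <= k -> marked s (last d p)) ->
  runs W (For 7 1 relax) (loop_time m 40) s (fun s' => partial s0 s' /\
    forall p, path r d p -> size p <= k.+1 -> marked s' (last d p)).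
Proof.
move=> ld pt up; have [[_ m1 _ _] _ _ _] := ld.
pose J k s' := [/\ partial s0 s', forall x, marked s x -> marked s' x &
  forall k', k' < k -> marked s (src k') -> tgt k' != u -> tgt k' != v ->
    marked s' (tgt k')].
apply: (@runs_imp _ _ _ _ (J m)).
  move=> s' [pt' mono step]; split=> // p; case/lastP: p => [_ _|p y].
    by apply: mono; apply: (up [::]).
  rewrite rcons_path size_rcons last_rcons => /andP[pp /andP[]] /=.
  case/arcP=> k' km [sk tk] /andP[yu yv] sz.
  by rewrite -tk; apply: step => //; rewrite ?sk ?tk ?up.
apply: runs_for => // k' s' km ss rk [pt' mono step].
have ld' : loaded s' by apply: loaded_same ss _ ld.
apply: runs_imp (runs_relax ld' rk km pt') => s2 [pt2 mono2 step2].
split=> // [x /mono/mono2//|k2]; rewrite ltnS leq_eqVlt => /orP[/eqP->|lt] mk ku kv.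
  by apply: step2 => //; apply: mono.
by apply: mono2; apply: step.
Qed.

Lemma runs_rounds s0 s : loaded s -> partial s0 s -> marked s d ->
  runs W (For 6 0 (For 7 1 relax)) (loop_time n (loop_time m 40)) s
    (fun s' => partial s0 s' /\
       forall x : 'I_n, Defs.mem s' 3 (B * n + x) = reach2 e d u v x).
Proof.
move=> ld pt md; have [[n0 _ _ _] _ _ _] := ld.
pose J k s' := partial s0 s' /\
  forall p, path r d p -> size p <= k -> marked s' (last d p).
apply: (@runs_imp _ _ _ _ (J n)).
  move=> s' [pt' up]; split=> // x; have [p1 p2 _] := pt'.
  have [/connectP[p pp ->]|nr] := boolP (reach2 e d u v x).
    (* The simple path [d :: q] has at most [n] vertices, so [q] is within reach of [n] rounds. *)
    case/shortenP: pp => q pq uq _; have := up q pq; rewrite /marked.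
    have := max_card (mem (d :: q)); rewrite card_ord (card_uniqP uq) /=.
    move=> /ltnW qn /(_ qn).
    by have := p2 (last d q); case: (Defs.mem _ _ _) => [|[|]].
  by apply/eqP; apply: contraNT nr => /p1.
apply: runs_for => //.
  by split=> // p _; rewrite leqn0 size_eq0 => /eqP->.
move=> k s' kn ss rk [pt' up].
apply: (@runs_imp _ _ _ _ (J k.+1)) => //.
by apply: runs_round => //; apply: loaded_same ss _ ld.
Qed.

End Block.

Definition block (d u v : nat) : nat := (d * n + u) * n + v.

Lemma block_inj (d u v d' u' v' : 'I_n) :
  block d u v = block d' u' v' -> [/\ d = d', u = u' & v = v'].
Proof.
case/digit_inj => //; case/digit_inj => // dd uu vv.
by split; apply: val_inj.
Qed.

Lemma block_lt (d u v : 'I_n) : block d u v < n ^ 3.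
Proof. by rewrite (expnSr n 2) (expnSr n 1) expn1 !digit_lt. Qed.

Lemma cell_inj (d u v x d' u' v' x' : 'I_n) :
  block d u v * n + x = block d' u' v' * n + x' ->
  [/\ d = d', u = u', v = v' & x = x'].
Proof.
case/digit_inj => // /block_inj[-> -> ->] xx.
by split=> //; apply: val_inj.
Qed.

(** Later rows are required to be zero so that each search starts with nothing marked. *)
Definition reach_table (B : nat) (s : state) : Prop :=
  (forall d u v x : 'I_n, block d u v < B ->
     Defs.mem s 3 (block d u v * n + x) = reach2 e d u v x) /\
  (forall j, B * n <= j -> Defs.mem s 3 j = 0).

Lemma runs_reach_block (d u v : 'I_n) s :
  env s -> reg s 2 = d -> reg s 3 = u -> reg s 4 = v ->
  reach_table (block d u v) s ->
  runs W reach_block (30 + loop_time n (loop_time m 40)) s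
    (reach_table (block d u v).+1).
Proof.
move=> en e2 e3 e4 [tab tab0]; have [n0 _ _ _] := en.
have Bn := block_lt d u v; set B := block d u v in tab tab0 Bn *.
have E5 : eval s (Op OpMul (Op OpAdd (Op OpMul (Op OpAdd (Op OpMul (Reg 2) (Reg 0))
    (Reg 3)) (Reg 0)) (Reg 4)) (Reg 0)) = B * n by rewrite /= n0 e2 e3 e4.
apply: (@runs_le _ _ (12 + (5 + loop_time n (loop_time m 40)))); last by lia.
apply: (@runs_seq _ _ _ _ _ _ (eq (put_reg s 5 (B * n)))).
  apply: runs_assign; rewrite E5 //.
  by apply: leq_trans (addrW Bn (ltn_ord d)); rewrite leq_addr.
move=> _ <-.
apply: (@runs_seq _ _ _ _ _ _
    (eq (put_mem (put_reg s 5 (B * n)) 3 (B * n + d) 1))).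
  apply: runs_le (runs_write _ _ _) _ => //=; rewrite ?e2 //.
  exact: addrW.
move=> _ <-; set s1 := put_mem _ _ _ _.
have ld : loaded u v B s1 by split.
have m1 x : Defs.mem s1 3 (B * n + x) = (x == d).
  by rewrite /s1 /= eqn_add2l; case: eqP => // _; rewrite tab0 ?leq_addr.
have pt : partial d u v B s s1.
  split=> [x|x|j jB].
  - by rewrite m1 eqb0 negbK => /eqP/val_inj->; apply: connect0.
  - by rewrite m1 leq_b1.
  - by rewrite /s1 /=; case: eqP => // E; have := ltn_ord d; lia.
have md : marked B s1 d by rewrite /marked m1 eqxx.
apply: runs_imp (runs_rounds Bn ld pt md) => s' [[_ _ out] done].
split=> [d' u' v' x|j jB]; last by rewrite out ?jB ?orbT // tab0; lia.
rewrite ltnS leq_eqVlt => /orP[/eqP E|lt].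
  by rewrite E done; have [-> -> ->] := block_inj E.
by rewrite out ?digit_lt // tab.
Qed.

Definition reach_phase : cmd := nest [:: 2; 3; 4] reach_block.

Lemma runs_reach_phase s :
  env s -> (forall j, Defs.mem s 3 j = 0) ->
  runs W reach_phase
    (iter 3 (loop_time n) (30 + loop_time n (loop_time m 40))) s
    (fun s' => forall d u v x : 'I_n,
       Defs.mem s' 3 (block d u v * n + x) = reach2 e d u v x).
Proof.
move=> en z; have [n0 _ _ _] := en.
apply: (@runs_imp _ _ _ _ (reach_table (1 * n ^ 3))).
  by move=> s' [tab _] d u v x; apply: tab; rewrite mul1n block_lt.
apply: (@runs_nest _ n _ _ _ [:: 2; 3; 4] 0) => //.
- by move=> r; rewrite !inE => /or3P[] /eqP->.
- move=> s' ss bnd.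
  have b2 := bnd 2 isT; have b3 := bnd 3 isT; have b4 := bnd 4 isT.
  apply: (@runs_reach_block (Ordinal b2) (Ordinal b3) (Ordinal b4)) => //.
  by apply: env_same ss _ _ _ _ en.
Qed.

(** * The table of fans to two vertices *)

Definition cell (a b c d : nat) : expr :=
  Op OpAdd (Op OpMul (Op OpAdd (Op OpMul (Op OpAdd (Op OpMul (Reg a) (Reg 0))
    (Reg b)) (Reg 0)) (Reg c)) (Reg 0)) (Reg d).

Lemma eval_cell s a b c d : reg s 0 = n ->
  eval s (cell a b c d) = block (reg s a) (reg s b) (reg s c) * n + reg s d.
Proof. by move=> /= ->. Qed.

(** Register 6 is the flag of a universal quantifier: it starts at 1 and is cleared by any [v] that
    cuts [d] from both targets. *)
Definition fan_step : cmd :=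
  If (Op OpAdd (Read 3 (cell 2 3 7 4)) (Read 3 (cell 2 3 7 5)))
     Skip (Assign 6 (Const 0)).

Definition fan_block : cmd :=
  Seq (Assign 6 (Const 1))
      (Seq (For 7 0 fan_step) (Write 4 (cell 2 3 4 5) (Reg 6))).

Definition fan_table (q : nat) (s : state) : Prop :=
  forall d u x y : 'I_n, block d u x * n + y < q ->
    Defs.mem s 4 (block d u x * n + y) = fan2 e d u x y.

Lemma cell_lt (d u v x : 'I_n) : block d u v * n + x < n ^ 4.
Proof. by rewrite (expnSr n 3) digit_lt ?block_lt. Qed.

Lemma forall_ltS (P : pred 'I_n) k (kn : k < n) :
  [forall v : 'I_n, (v < k.+1) ==> P v] =
  [forall v : 'I_n, (v < k) ==> P v] && P (Ordinal kn).
Proof.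
apply/forallP/andP => [h|[/forallP h Pk] v].
  split; last by have := h (Ordinal kn); rewrite ltnSn.
  by apply/forallP => v; apply/implyP => vk; apply: (implyP (h v)); apply: ltnW.
apply/implyP; rewrite ltnS leq_eqVlt => /orP[/eqP E|vk].
  by rewrite (_ : v = Ordinal kn) //; apply: val_inj.
exact: implyP (h v) vk.
Qed.

Lemma forall_lt_all (P : pred 'I_n) :
  [forall v : 'I_n, (v < n) ==> P v] = [forall v, P v].
Proof. by apply: eq_forallb => v; rewrite ltn_ord. Qed.

Lemma forall_lt0 (P : pred 'I_n) : [forall v : 'I_n, (v < 0) ==> P v].
Proof. exact/forallP. Qed.

Lemma runs_fan_block (d u x y : 'I_n) s :
  reg s 0 = n ->
  reg s 2 = d -> reg s 3 = u -> reg s 4 = x -> reg s 5 = y ->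
  (forall d u v x : 'I_n,
     Defs.mem s 3 (block d u v * n + x) = reach2 e d u v x) ->
  fan_table (block d u x * n + y) s ->
  runs W fan_block (30 + loop_time n 40) s (fan_table (block d u x * n + y).+1).
Proof.
move=> n0 e2 e3 e4 e5 rt ft.
pose P v := reach2 e d u v x || reach2 e d u v y.
apply: (@runs_le _ _ (2 + (loop_time n 40 + 20))); last by clear; lia.
apply: (@runs_seq _ _ _ _ _ _ (eq (put_reg s 6 1))); first exact: runs_assign.
move=> _ <-; set s1 := put_reg _ _ _.
pose J k s' := reg s' 6 = [forall v : 'I_n, (v < k) ==> P v].
have L : runs W (For 7 0 fan_step) (loop_time n 40) s1 (J n).
  apply: runs_for => //.
    by rewrite /J /= forall_lt0.
  move=> k s' kn ss rk Jk.
  have E z : z \in [:: 4; 5] -> eval s' (Read 3 (cell 2 3 7 z)) =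
      Defs.mem s 3 (block d u (Ordinal kn) * n + reg s z).
    move=> zz; rewrite -[LHS]/(Defs.mem s' 3 (eval s' (cell 2 3 7 z))).
    have z67 : z \notin [:: 7; 6] by move: zz; rewrite !inE => /orP[] /eqP->.
    have rz : reg s' z = reg s z.
      by rewrite ss.1 //=; move: z67; rewrite !inE negb_or => /andP[_ /negPf->].
    have [r0 r2 r3] : [/\ reg s' 0 = n, reg s' 2 = d & reg s' 3 = u].
      by rewrite !ss.1.
    by rewrite eval_cell // ss.2 // r2 r3 rk rz.
  apply: runs_le (runs_if (T1 := 1) (T2 := 2) _ _) _ => //;
    rewrite -[eval _ _]/(eval s' (Read 3 (cell 2 3 7 4)) +
                         eval s' (Read 3 (cell 2 3 7 5))) !E // e4 e5 !rt => C.
    apply: runs_skip; rewrite /J /= forall_ltS Jk /P.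
    by move: C; do 2![case: reach2] => //=; rewrite andbT.
  apply: runs_assign => //; rewrite /J /= forall_ltS /P.
  by move: C; do 2![case: reach2] => //=; rewrite andbF.
apply: runs_seq (runs_same L) _ => s2 [J2 ss2].
have ec : eval s2 (cell 2 3 4 5) = block d u x * n + y.
  by rewrite eval_cell !ss2.1 //= e2 e3 e4 e5.
apply: runs_le (runs_write _ _ _) _ => //.
- by rewrite ec (leq_trans _ n4W) // ltnW // cell_lt.
- by rewrite /= J2; case: [forall v, _].
rewrite ec => d' u' x' y'; rewrite ltnS leq_eqVlt /=.
case: eqP => [/cell_inj[-> -> -> ->] _|_ /= lt].
  by rewrite J2 forall_lt_all.
by rewrite ss2.2 //=; apply: ft.
Qed.

Definition fan_phase : cmd := nest [:: 2; 3; 4; 5] fan_block.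

Lemma runs_fan_phase s : reg s 0 = n ->
  (forall d u v x : 'I_n,
     Defs.mem s 3 (block d u v * n + x) = reach2 e d u v x) ->
  runs W fan_phase (iter 4 (loop_time n) (30 + loop_time n 40)) s
    (fun s' => forall d u x y : 'I_n,
       Defs.mem s' 4 (block d u x * n + y) = fan2 e d u x y).
Proof.
move=> n0 rt.
apply: (@runs_imp _ _ _ _ (fan_table (1 * n ^ 4))).
  by move=> s' tab d u v x; apply: tab; rewrite mul1n cell_lt.
apply: (@runs_nest _ n _ _ _ [:: 2; 3; 4; 5] 0) => //.
- by move=> r; rewrite !inE => /or4P[] /eqP->.
- move=> s' ss bnd.
  have b2 := bnd 2 isT; have b3 := bnd 3 isT; have b4 := bnd 4 isT.
  have b5 := bnd 5 isT.
  apply: (@runs_fan_block (Ordinal b2) (Ordinal b3) (Ordinal b4) (Ordinal b5)) => //.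
    by rewrite ss.1.
  by move=> d u v x; rewrite ss.2.
Qed.

End Search.

(** * Testing all quadruples of vertices *)

Section Test.
Variables (n W : nat) (e : rel 'I_n).
Hypothesis nW : n <= W.
Hypothesis W1 : 0 < W.

(** Counts coincidences among the four vertices, hence vanishes iff they are distinct. *)
Definition eq_sum : expr :=
  let eq i j := Op OpEq (Reg i) (Reg j) in
  Op OpAdd (eq 3 4) (Op OpAdd (eq 3 5) (Op OpAdd (eq 3 2)
    (Op OpAdd (eq 4 5) (Op OpAdd (eq 4 2) (eq 5 2))))).

Definition test_step : cmd :=
  If (Op OpAdd (Read 4 (cell 2 7 3 4))
       (Op OpAdd (Read 4 (cell 2 7 3 5)) (Read 4 (cell 2 7 4 5))))
     Skip (Assign 6 (Const 0)).

(** Registers 2 to 5 hold [d], [a], [b], [c]; multiplication is conjunction. Register 8 is never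
    reset, so it records whether any quadruple has passed. *)
Definition test_block : cmd :=
  Seq (Assign 6 (Op OpMul (Op OpEq eq_sum (Const 0)) (Read 4 (cell 4 2 3 5))))
      (Seq (For 7 0 test_step) (If (Reg 6) (Assign 8 (Const 1)) Skip)).

Definition found (q : nat) (s : state) : Prop :=
  reg s 8 != 0 <-> exists d a b c : 'I_n,
    block n d a b * n + c < q /\ z4_test e d a b c.

Lemma runs_test_block (d a b c : 'I_n) s :
  reg s 0 = n ->
  reg s 2 = d -> reg s 3 = a -> reg s 4 = b -> reg s 5 = c ->
  (forall d u x y : 'I_n,
     Defs.mem s 4 (block n d u x * n + y) = fan2 e d u x y) ->
  found (block n d a b * n + c) s ->
  runs W test_block (60 + loop_time n 70) s (found (block n d a b * n + c).+1).
Proof.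
move=> n0 e2 e3 e4 e5 ft fd.
pose P u := [|| fan2 e d u a b, fan2 e d u a c | fan2 e d u b c].
pose D := uniq [:: a; b; c; d] && fan2 e b d a c.
apply: (@runs_le _ _ (50 + (loop_time n 70 + 5))); last by lia.
apply: (@runs_seq _ _ _ _ _ _ (eq (put_reg s 6 D))).
  have E : eval s (Op OpMul (Op OpEq eq_sum (Const 0)) (Read 4 (cell 4 2 3 5))) = D.
    rewrite -[LHS]/((eval s eq_sum == 0) * Defs.mem s 4 (eval s (cell 4 2 3 5))).
    rewrite (eval_cell _ _ _ _ n0) e2 e3 e4 e5 ft /D mulnb; congr (nat_of_bool (_ && _)).
    rewrite /= e2 e3 e4 e5 !inE !negb_or !val_eqE.
    by case: (a == b); case: (a == c); case: (a == d); case: (b == c);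
      case: (b == d); case: (c == d).
  apply: runs_le (runs_assign _ _) _ => //; rewrite E //.
  by apply: leq_trans (leq_b1 _) W1.
move=> _ <-; set s1 := put_reg _ _ _.
pose J k s' := reg s' 6 = D && [forall u : 'I_n, (u < k) ==> P u].
have L : runs W (For 7 0 test_step) (loop_time n 70) s1 (J n).
  apply: runs_for => //.
    by rewrite /J /= (forall_lt0 P) andbT.
  move=> k s' kn ss rk Jk.
  have [r0 r2 r3] : [/\ reg s' 0 = n, reg s' 2 = d & reg s' 3 = a].
    by rewrite !ss.1.
  have [r4 r5] : reg s' 4 = b /\ reg s' 5 = c by rewrite !ss.1.
  have E : eval s' (Op OpAdd (Read 4 (cell 2 7 3 4))
       (Op OpAdd (Read 4 (cell 2 7 3 5)) (Read 4 (cell 2 7 4 5)))) =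
      fan2 e d (Ordinal kn) a b + (fan2 e d (Ordinal kn) a c + fan2 e d (Ordinal kn) b c).
    rewrite -!ft -[LHS]/(Defs.mem s' 4 (eval s' (cell 2 7 3 4)) +
      (Defs.mem s' 4 (eval s' (cell 2 7 3 5)) + Defs.mem s' 4 (eval s' (cell 2 7 4 5)))).
    by rewrite !(eval_cell _ _ _ _ r0) r2 r3 r4 r5 rk !ss.2.
  apply: runs_le (runs_if (T1 := 1) (T2 := 2) _ _) _ => //; rewrite E => C.
    apply: runs_skip; rewrite /J /= forall_ltS Jk /P.
    by move: C; do 3![case: fan2] => //=; rewrite andbT.
  apply: runs_assign => //; rewrite /J /= forall_ltS /P.
  by move: C; do 3![case: fan2] => //=; rewrite !andbF.
apply: runs_seq (runs_same L) _ => s2 [J2 ss2].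
have {}J2 : reg s2 6 = z4_test e d a b c.
  by rewrite J2 forall_lt_all /D -andbA.
have fd2 : found (block n d a b * n + c) s2 by rewrite /found ss2.1.
have step : (exists d' a' b' c' : 'I_n,
      block n d' a' b' * n + c' < (block n d a b * n + c).+1 /\ z4_test e d' a' b' c') <->
    z4_test e d a b c \/ exists d' a' b' c' : 'I_n,
      block n d' a' b' * n + c' < block n d a b * n + c /\ z4_test e d' a' b' c'.
  split=> [[d' [a' [b' [c' []]]]]|[t|[d' [a' [b' [c' [lt t]]]]]]].
  - rewrite ltnS leq_eqVlt => /orP[/eqP/cell_inj[-> -> -> ->]|lt] t; first by left.
    by right; exists d', a', b', c'.
  - by exists d, a, b, c.
  - by exists d', a', b', c'; split=> //; apply: ltnW.
apply: runs_le (runs_if (T1 := 2) (T2 := 1) _ _) _ => //= C.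
  apply: runs_assign => //; split=> // _; apply/step; left.
  by move: C; rewrite J2; case: z4_test.
apply: runs_skip; split=> [/fd2 h|]; first by apply/step; right.
by case/step => [t|/fd2//]; rewrite J2 t in C.
Qed.

Definition test_phase : cmd := nest [:: 2; 3; 4; 5] test_block.

Lemma runs_test_phase s : reg s 0 = n -> reg s 8 = 0 ->
  (forall d u x y : 'I_n,
     Defs.mem s 4 (block n d u x * n + y) = fan2 e d u x y) ->
  runs W test_phase (iter 4 (loop_time n) (60 + loop_time n 70)) s
    (fun s' => reg s' 8 != 0 <-> exists d a b c : 'I_n, z4_test e d a b c).
Proof.
move=> n0 r8 ft.
apply: (@runs_imp _ _ _ _ (found (1 * n ^ 4))).
  move=> s' fd; apply: (iff_trans fd); rewrite mul1n; split=> [[d [a [b [c [_ t]]]]]|[d [a [b [c t]]]]].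
    by exists d, a, b, c.
  by exists d, a, b, c; rewrite cell_lt.
apply: (@runs_nest _ n _ _ _ [:: 2; 3; 4; 5] 0) => //.
- by move=> r; rewrite !inE => /or4P[] /eqP->.
- by move=> r k q s'; rewrite !inE /found => /or4P[] /eqP->.
- move=> s' ss bnd.
  have b2 := bnd 2 isT; have b3 := bnd 3 isT; have b4 := bnd 4 isT.
  have b5 := bnd 5 isT.
  apply: (@runs_test_block (Ordinal b2) (Ordinal b3) (Ordinal b4) (Ordinal b5)) => //.
    by rewrite ss.1.
  by move=> d u x y; rewrite ss.2.
- by split=> [|[d [a [b [c []]]]]] //; rewrite r8.
Qed.

End Test.

(* The [k]-th arc leaves the last vertex whose list starts at or before cell
   [k]; later writes to [src k] overwrite earlier ones. *)
Definition source_phase : cmd :=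
  For 2 0 (For 3 1 (If (Op OpLt (Read 0 (Reg 2)) (Op OpAdd (Reg 3) (Const 1)))
                       (Write 2 (Reg 3) (Reg 2)) Skip)).

Lemma runs_source_phase n m W (src : nat -> nat) s :
  n <= W -> m <= W -> reg s 0 = n -> reg s 1 = m ->
  (forall k, k < m -> src k < n) ->
  (forall i k, i < n -> k < m -> (Defs.mem s 0 i <= k) = (i <= src k)) ->
  (forall k, Defs.mem s 2 k = 0) ->
  runs W source_phase (loop_time n (loop_time m 20)) s
    (fun s' => forall k, k < m -> Defs.mem s' 2 k = src k).
Proof.
move=> nW mW n0 m1 srcn off z.
(* Of the vertices below [i], the last one written to cell [k] is the largest not above [src k]; at
   [i = 0] this gives 0, the initial content. *)
pose J i s' := forall k, k < m -> Defs.mem s' 2 k = minn i.-1 (src k).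
apply: (@runs_imp _ _ _ _ (J n)).
  by move=> s' J' k km; rewrite J' //; have := srcn k km; lia.
apply: runs_for => //; first by move=> k km; rewrite /= z min0n.
move=> i s1 iN ss1 r2 Ji.
pose K k s' := forall k', k' < m ->
  Defs.mem s' 2 k' = if k' < k then minn i (src k') else minn i.-1 (src k').
apply: (@runs_imp _ _ _ _ (K m)).
  by move=> s' K' k km; rewrite /= K' // km.
apply: runs_for => //; first by rewrite ss1.1.
move=> k s2 km ss2 r3 Kk.
have o2 : Defs.mem s2 0 i = Defs.mem s 0 i by rewrite ss2.2 // ss1.2.
have r2' : reg s2 2 = i by rewrite ss2.1.
apply: runs_le (runs_if (T1 := 3) (T2 := 1) _ _) _ => //=;
  rewrite r2' o2 r3 addn1 ltnS off // => C.
  apply: runs_le (runs_write _ _ _) _ => //=; rewrite ?r2' ?r3; try by lia.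
  move=> k' km' /=; case: (k' =P k) => [->|kk].
    by rewrite ltnSn; move: C; case: leqP => // *; lia.
  by rewrite Kk // [k' < k.+1]ltnS [k' <= k]leq_eqVlt; case: eqP kk.
apply: runs_skip => k' km' /=; rewrite Kk // [k' < k.+1]ltnS [k' <= k]leq_eqVlt.
case: (k' =P k) => //= kk; rewrite kk ltnn; move: C; case: leqP => // *; lia.
Qed.

(** * Decoding the concatenated adjacency lists *)

Lemma leq_sumn_take (sh : seq nat) i j :
  i <= j -> sumn (take i sh) <= sumn (take j sh).
Proof.
move=> ij; rewrite -(cat_take_drop i (take j sh)) take_takel // sumn_cat.
exact: leq_addr.
Qed.

Lemma reshape_index_offset (sh : seq nat) k : k < sumn sh ->
  k = sumn (take (reshape_index sh k) sh) + reshape_offset sh k.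
Proof. by rewrite -[LHS](reshape_indexK sh). Qed.

(** Justifies the test of [source_phase]: with empty lists several rows start at the same cell, and
    [reshape_index] is the last row starting at or before [k]. *)
Lemma leq_reshape_index (sh : seq nat) i k : k < sumn sh ->
  (sumn (take i sh) <= k) = (i <= reshape_index sh k).
Proof.
move=> ks; have ki := reshape_index_offset ks; have ko := reshape_offsetP ks.
have ri := reshape_indexP ks; case: leqP => h.
  apply/esym; rewrite leqNgt; apply/negP => ir.
  have := leq_sumn_take sh ir; rewrite (take_nth 0) // sumn_rcons; lia.
apply/esym/negbTE; rewrite -ltnNge ltnNge; apply/negP => ir.
by have := leq_sumn_take sh ir; lia.
Qed.

Lemma nth_offsets (sh : seq nat) i :
  i <= size sh -> nth 0 (0 :: scanl addn 0 sh) i = sumn (take i sh).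
Proof.
have foldl_sumn x s : foldl addn x s = x + sumn s.
  by elim: s x => [|y s IHs] x /=; rewrite ?addn0 // IHs addnA.
by move=> le; rewrite nth_cons_scanl // foldl_sumn.
Qed.

Section Adjacency.
Variables (D : digraph) (adj : seq (seq nat)).
Hypothesis adjD : adjacency_lists D adj.
Let n := nvertices D.
Let src := reshape_index (shape adj).
Let tgt := nth 0 (flatten adj).
Let m := size (flatten adj).

Lemma size_adj : size adj = n.
Proof. by case: adjD => num []. Qed.

Lemma adj_row (i : 'I_n) : exists2 u : D,
  size (nth [::] adj i) = #|is_arc u| & forall j, j \in nth [::] adj i -> j < n.
Proof.
have [num [numi _ adjP]] := adjD.
have [|g _ Kg] := inj_card_bij numi; first by rewrite card_ord.
exists (g i); first by rewrite -{1}[i]Kg (perm_size (adjP _)) size_map cardE.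
by move=> j; rewrite -{1}[i]Kg (perm_mem (adjP _)) => /mapP[v _ ->]; exact: ltn_ord.
Qed.

(** The out-degrees sum to the number of arcs. *)
Lemma size_flatten_adj : m = narcs D.
Proof.
have [num [numi _ adjP]] := adjD.
rewrite /m size_flatten sumnE big_map (big_nth [::]) size_adj big_mkord.
rewrite (reindex num) /=; last first.
  by apply: onW_bij; apply: inj_card_bij numi _; rewrite card_ord.
rewrite (eq_bigr (fun u : D => #|is_arc u|)); last first.
  by move=> u _; rewrite (perm_size (adjP u)) size_map cardE.
rewrite /narcs cardsE -sum1_card.
rewrite (eq_bigr (fun u : D => \sum_(v | is_arc u v) 1)); last first.
  by move=> u _; rewrite -sum1_card.
by rewrite pair_big_dep.
Qed.

Lemma src_lt k : k < m -> src k < n.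
Proof. by rewrite /m size_flatten => /reshape_indexP; rewrite size_map size_adj. Qed.

Lemma tgt_mem k : k < m -> tgt k \in nth [::] adj (src k).
Proof.
move=> km; rewrite /tgt nth_flatten mem_nth //.
have := km; rewrite /m size_flatten => /reshape_offsetP.
by rewrite (nth_map [::]) // size_adj src_lt.
Qed.

Lemma tgt_lt k : k < m -> tgt k < n.
Proof.
move=> km; have [u _] := adj_row (Ordinal (src_lt km)); apply.
exact: tgt_mem.
Qed.

Lemma adj_relP (i j : 'I_n) :
  reflect (exists2 k, k < m & src k = i /\ tgt k = j) (adj_rel adj i j).
Proof.
apply: (iffP idP) => [ij|[k km [si tj]]]; last first.
  by rewrite /adj_rel -si /= -tj tgt_mem.
have c : index (val j) (nth [::] adj i) < nth 0 (shape adj) i.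
  by rewrite (nth_map [::]) ?size_adj // index_mem.
exists (flatten_index (shape adj) i (index (val j) (nth [::] adj i))).
  by rewrite /m size_flatten flatten_indexP.
by rewrite /src /tgt nth_flatten flatten_indexKl // flatten_indexKr // nth_index.
Qed.

End Adjacency.

(** * The whole program and its running time *)

Definition z4_program : cmd :=
  Seq source_phase (Seq reach_phase (Seq fan_phase (Seq test_phase
    (Assign 0 (Op OpLt (Const 0) (Reg 8)))))).

Definition z4_time (n m : nat) : nat :=
  loop_time n (loop_time m 20) +
  (iter 3 (loop_time n) (30 + loop_time n (loop_time m 40)) +
  (iter 4 (loop_time n) (30 + loop_time n 40) +
  (iter 4 (loop_time n) (60 + loop_time n 70) + 4))).

(** The time is a polynomial without a pure power of [m], so for positive [n] each nonconstant
    monomial is at most [X]; its coefficients sum to 532. *)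
Lemma z4_time_le n m : z4_time n m <= 600 * (n ^ 4 * (n + m)).+1.
Proof.
rewrite /z4_time /loop_time /=; case: (posnP n) => [->|n0]; first by lia.
have le1 : 1 <= n ^ 4 by rewrite expn_gt0 n0.
have e4 : n ^ 4 = n * (n * (n * n)) by rewrite !expnS expn0 muln1.
set X := n ^ 4 * (n + m).
have n5 : n * (n * (n * (n * n))) <= X by rewrite /X e4; nia.
have n4m : n * (n * (n * (n * m))) <= X by rewrite /X e4; nia.
have n4 : n * (n * (n * n)) <= X by nia.
have n3 : n * (n * n) <= X by nia.
have n2 : n * n <= X by nia.
have n1 : n <= X by nia.
have n3m : n * (n * (n * m)) <= X by nia.
have n2m : n * (n * m) <= X by nia.
have n1m : n * m <= X by nia.
lia.
Qed.

Theorem theorem25 :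
  solvable_in_time (has_subdivision Z4) (fun n m : nat => n ^ 4 * (n + m)).
Proof.
(* 600 comes from the time bound; the exponent 4 lets words hold the table indices, which are below
   [n ^ 4]. *)
exists z4_program, 600, 4 => D adj n m adjD.
set W := 600 * _.
have nS : size adj = n := size_adj adjD.
have mS : size (flatten adj) = m := size_flatten_adj adjD.
have big : (n + m).+1 ^ 4 <= W by rewrite leq_pmull.
have nmW : n + m < W.
  by apply: leq_trans big; rewrite -[leqLHS]expn1 leq_pexp2l.
have n4W : n ^ 4 <= W.
  by apply: leq_trans big; rewrite leq_exp2r //; lia.
have [nW mW W1] : [/\ n <= W, m <= W & 0 < W] by split; lia.
pose src := reshape_index (shape adj); pose tgt := nth 0 (flatten adj).
have srcP k : k < m -> src k < n by rewrite -mS => /(src_lt adjD).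
have tgtP k : k < m -> tgt k < n by rewrite -mS => /(tgt_lt adjD).
have arcP (i j : 'I_n) :
    reflect (exists2 k, k < m & src k = i /\ tgt k = j) (adj_rel adj i j).
  by rewrite -mS; apply: adj_relP.
suff : runs W z4_program (z4_time n m) (input adj)
    (fun s => reg s 0 != 0 <-> has_subdivision Z4 D).
  case=> t [s [ex le ans]]; exists t, s; split=> //.
  exact: leq_trans le (z4_time_le n m).
apply: runs_seq.
  apply: (runs_same (runs_source_phase (src := src) nW mW _ _ srcP _ _)) => //.
  move=> i k iN km; rewrite /= nth_offsets ?size_map ?nS; last exact: ltnW.
  by rewrite leq_reshape_index // -size_flatten mS.
move=> s1 [srcs ss1].
have en1 : env n m src tgt s1.
  by split=> // [||k km]; rewrite ?ss1.1 //= ?ss1.2.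
apply: runs_seq.
  apply: (runs_same (runs_reach_phase srcP tgtP arcP nW mW W1 n4W en1 _)).
  by move=> j; rewrite ss1.2.
move=> s2 [reach ss2].
apply: runs_seq.
  apply: (runs_same (runs_fan_phase nW W1 n4W _ reach)).
  by rewrite ss2.1 // ss1.1.
move=> s3 [fans ss3].
apply: runs_seq.
  apply: (runs_test_phase nW W1 _ _ fans); first by rewrite ss3.1 // ss2.1 // ss1.1.
  by rewrite ss3.1 // ss2.1 // ss1.1.
move=> s4 ans; apply: runs_assign => /=; first by case: (_ < _).
rewrite eqb0 negbK lt0n; apply: iff_trans ans _.
apply: iff_trans (iff_sym (has_subdivision_z4 D)).
apply: iff_trans (iff_sym (adjacency_z4_model adjD)).
split=> [[d [a [b [c]]]]|]; first exact: z4_test_model.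
exact: z4_model_test.
Qed.
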